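(* Let $K$ be a local field, $\mathcal{O}_K$ its ring of integers, and $\mathfrak{m}_K$ the prime ideal of $\mathcal{O}_K$. Let $d \in K$ be a non-square with $d(d-1)\neq 0$, and let $E$ be the Edwards curve $\hat{x}^2+\hat{y}^2 = 1 + d\hat{x}^2\hat{y}^2$ over $K$. Let $x_1 \in K\setminus\{0\}$ be such that $x_1$ and $1-d$ are both squares or both non-squares in $K$, let $y_1\in K$ satisfy $y_1^2 = \frac{4x_1^3}{1-d}$, and put $a' = 2x_1\frac{1+d}{1-d}$, $b' = x_1^2$. Assume that $E$ and the associated Weierstrass curves have non-singular reduction modulo $\mathfrak{m}_K$ (see context). Let $\wp$ and $\wp'$ be the Weierstrass function and its derivative (as Laurent series in $z$ over $K$) attached to the short Weierstrass form of $y^2 = x^3+a'x^2+b'x$. Then the map $$\mathrm{Exp}_E\colon \mathfrak{m}_K \longrightarrow J^0_K(E),\qquad z\longmapsto \left(\frac{2}{3}\,\frac{y_1\,(3\wp(z)-a')}{x_1\,\wp'(z)},\ \frac{3\wp(z)-a'-3x_1}{3\wp(z)-a'+3x_1}\right),$$ with $\mathrm{Exp}_E(0) = (0,1)$, is an exponential map for $E$, that is, $\mathrm{Exp}_E(z_1+z_2) = \mathrm{Exp}_E(z_1)+\mathrm{Exp}_E(z_2)$ for all $z_1,z_2\in\mathfrak{m}_K$.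
   Context: Local fields here are non-archimedean (with a ring of integers and a prime ideal), and the characteristic of $K$ is different from $2$. $\mathfrak{m}_K$ is regarded as an additive group. Group $J^0_K(E)$: since $d$ is a non-square in $K$, the affine $K$-rational points of $E$ form a group with neutral element $O=(0,1)$ under $$(x_P,y_P)+(x_Q,y_Q) = \left(\frac{x_Py_Q+x_Qy_P}{1+d\,x_Px_Qy_Py_Q},\ \frac{y_Py_Q-x_Px_Q}{1-d\,x_Px_Qy_Py_Q}\right),$$ and $J^0_K(E)$ is this group (a point $P$ being identified with the divisor class of $P-O$). Weierstrass curves: $W$ is the curve $y^2=x^3+a'x^2+b'x$. Its short Weierstrass form $\overline{W}$ is $\bar{y}^2=\bar{x}^3+a\bar{x}+b$, obtained by $x = \bar{x}-\frac{a'}{3}$, $y=\bar{y}$, so $a = b'-\frac{a'^2}{3}$ and $b = \frac{2a'^3}{27}-\frac{a'b'}{3}$. Put $g_2=-4a$, $g_3=-4b$. Weierstrass function over $K$: $$\wp(z) = \frac{1}{z^2}+\sum_{k\ge 2} c_k z^{2k-2},\qquad \wp'(z) = -\frac{2}{z^3}+\sum_{k\geq 2}(2k-2)c_kz^{2k-3},$$ with $c_2=\frac{g_2}{20}$, $c_3=\frac{g_3}{28}$ and $c_k=\frac{3}{(2k+1)(k-3)}\sum_{m=2}^{k-2}c_mc_{k-m}$ for $k\ge 4$. Formally $\left(\frac{\wp'}{2}\right)^2=\wp^3-\frac{g_2}{4}\wp-\frac{g_3}{4}$. Standing assumptions: these series are considered on a neighborhood of zero in which they make sense and converge, and $\mathfrak{m}_K$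 is taken to be such a neighborhood. The reduction of $E$ modulo $\mathfrak{m}_K$ is non-singular, meaning that $E$ reduces to an Edwards curve over the residue field $k=\mathcal{O}_K/\mathfrak{m}_K$ (the reduced parameter $\bar d$ satisfies $\bar d(\bar d-1)\ne 0$), and the reductions of $W$ and $\overline{W}$ modulo $\mathfrak{m}_K$ are non-singular. *)

(* Defs.v *)
From HB Require Import structures.
From mathcomp Require Import all_boot all_order all_algebra.
From mathcomp Require Import generic_quotient ring_quotient.
From mathcomp Require Import boolp classical_sets functions cardinality constructive_ereal topology.

Set Implicit Arguments.
Unset Strict Implicit.
Unset Printing Implicit Defensive.

Import Order.TTheory GRing.Theory Num.Theory.
Local Open Scope ring_scope.

(* Normalised discrete valuations K -> Z u {+oo}. *)
HB.mixin Record isDiscretelyValued K of GRing.Field K := {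
  valuation : K -> \bar int;
  valuation_eqoo : forall x, (valuation x == +oo%E) = (x == 0);
  valuationM : forall x y,
    valuation (x * y) = (valuation x + valuation y)%E;
  valuationD : forall x y,
    (Order.min (valuation x) (valuation y) <= valuation (x + y)%R)%E;
  valuation_uniformizer : exists pi, valuation pi = 1%:E
}.

#[short(type="dvalFieldType")]
HB.structure Definition DValField :=
  {K of GRing.Field K & isDiscretelyValued K}.

Section DValFieldTheory.
Variable K : dvalFieldType.
Implicit Types x y : K.
Local Notation v := (@valuation K).

Lemma valuation1 : v 1 = 0%E.
Proof.
have [p vp] := @valuation_uniformizer K.
have := @valuationM K 1 p; rewrite mul1r vp.
case: (v 1) => [n| |] //= [] e; congr (_%:E).
by apply: (addIr 1); rewrite -e add0r.
Qed.

Lemma valuation0 : v 0 = +oo%E.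
Proof. by apply/eqP; rewrite valuation_eqoo. Qed.

Lemma valuationN x : v (- x) = v x.
Proof.
have vN1 : v (-1) = 0%E.
  have := @valuationM K (-1) (-1); rewrite mulrNN mulr1 valuation1.
  case: (v (-1)) => [n| |] //= [] /eqP.
  by rewrite eq_sym -mulr2n mulrn_eq0 /= => /eqP ->.
by rewrite -mulN1r valuationM vN1 add0e.
Qed.

Lemma valuationB x y z :
  (Order.min (v (x - y)%R) (v (y - z)%R) <= v (x - z)%R)%E.
Proof. by rewrite -(subrKA y x (- z)); exact: valuationD. Qed.

Lemma valuationV x : x != 0 -> (v x + v x^-1%R = 0)%E.
Proof. by move=> x0; rewrite -valuationM divff// valuation1. Qed.

Definition is_integer x : bool := (0 <= v x)%E.

Lemma is_integer_subring : subring_closed is_integer.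
Proof.
split=> [|x y|x y]; rewrite /is_integer !unfold_in.
- by rewrite valuation1.
- move=> vx vy; apply: le_trans (@valuationD K x (- y)).
  by rewrite valuationN le_min vx vy.
- by move=> vx vy; rewrite valuationM; apply: adde_ge0.
Qed.

HB.instance Definition _ :=
  GRing.isSubringClosed.Build K is_integer is_integer_subring.

Record integer_ring := Integer { int_val :> K; _ : int_val \in is_integer }.
HB.instance Definition _ := [isSub for int_val].
HB.instance Definition _ := [Choice of integer_ring by <:].
HB.instance Definition _ := [SubChoice_isSubComNzRing of integer_ring by <:].

Definition max_ideal (a : integer_ring) : bool := (0 < v (int_val a))%E.

Lemma max_ideal_idealr : idealr_closed max_ideal.
Proof.
split; rewrite /max_ideal ?unfold_in /=.
- by rewrite valuation0.
- by rewrite valuation1.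
- move=> a x y; rewrite !unfold_in /= => vx vy.
  apply: lt_le_trans (@valuationD K _ _).
  rewrite lt_min vy andbT valuationM.
  case: a => a /=; rewrite unfold_in => va.
  exact: lt_le_trans vx (leeDr _ va).
Qed.

HB.instance Definition _ := isIdealr.Build integer_ring max_ideal
  max_ideal_idealr.

Definition max_idealr : idealr integer_ring := Idealr.clone _ max_ideal _.

Definition residue_field := {ideal_quot max_idealr}.
HB.instance Definition _ := GRing.ComNzRing.on residue_field.

Definition reduction (a : integer_ring) : residue_field :=
  (\pi_({ideal_quot max_idealr}) a)%qT.
HB.instance Definition _ := GRing.RMorphism.copy reduction
  (\pi_({ideal_quot max_idealr}))%qT.

Lemma reduction_eq0 a : (reduction a == 0) = (a \in max_ideal).
Proof. by rewrite -[a in RHS]subr0 Quotient.idealrBE rmorph0. Qed.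

Lemma reduction_surj (r : residue_field) : exists a, reduction a = r.
Proof.
by exists (repr (r : {ideal_quot max_idealr})); rewrite /reduction reprK.
Qed.

Lemma residue_has_inv (r : residue_field) :
  exists s : residue_field, if r == 0 then s = 0 else s * r = 1.
Proof.
have [_|y0] := eqVneq r 0; first by exists 0.
have [x xy] := reduction_surj r; move: y0; rewrite -xy reduction_eq0.
rewrite unfold_in => nvx.
have vx : v (int_val x) = 0%E.
  apply/eqP; rewrite eq_le; case: x nvx {xy} => x /=; rewrite unfold_in => vx.
  by rewrite -leNgt => ->.
have x0 : int_val x != 0 by rewrite -valuation_eqoo vx.
have vV : (int_val x)^-1 \in is_integer.
  by rewrite unfold_in -[leRHS]add0e -{2}vx valuationV.
exists (reduction (Integer vV)); rewrite -rmorphM /= -(rmorph1 reduction).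
by congr reduction; apply: val_inj; rewrite /= mulVf.
Qed.

Definition residue_inv r := projT1 (cid (residue_has_inv r)).

Lemma residue_mulVf r : r != 0 -> residue_inv r * r = 1.
Proof.
by rewrite /residue_inv; case: cid => z /=; case: eqVneq.
Qed.

Lemma residue_invr0 : residue_inv 0 = 0.
Proof. by rewrite /residue_inv; case: cid => z /=; rewrite eqxx. Qed.

HB.instance Definition _ :=
  GRing.ComNzRing_isField.Build residue_field residue_mulVf residue_invr0.

End DValFieldTheory.


Section ValuationTopology.
Variable K : dvalFieldType.
Local Notation v := (@valuation K).
Local Open Scope classical_set_scope.

(* An alias of K, so that the valuation topology does not interfere with the
   algebraic structures of K. *)
Definition valued_space : Type := K.
HB.instance Definition _ := Choice.on valued_space.
HB.instance Definition _ := isPointed.Build valued_space (0 : K).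

Definition val_ball (n : int) : set (valued_space * valued_space) :=
  [set xy | (n%:E <= v ((xy.1 : K) - (xy.2 : K))%R)%E].

Definition val_entourage : set_system (valued_space * valued_space) :=
  [set E | exists n, val_ball n `<=` E].

Lemma val_entourage_filter : Filter val_entourage.
Proof.
split=> [|P Q [m mP] [n nQ]|P Q PQ [n nP]]; first by exists 0.
  exists (Num.max m n) => xy xyB.
  by split; [apply: mP|apply: nQ]; apply: le_trans xyB;
    rewrite lee_fin le_max lexx ?orbT.
by exists n; apply: subset_trans PQ.
Qed.

Lemma val_entourage_diagonal E : val_entourage E -> diagonal `<=` E.
Proof.
move=> [n nE] [x y] xy; have {xy} <- : x = y := xy; apply: nE.
rewrite /val_ball/= subrr valuation0.
exact: leey.
Qed.

Lemma val_entourage_inv E : val_entourage E -> val_entourage (E^-1)%relation.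
Proof.
move=> [n nE]; exists n => -[x y] /= xyB; apply: nE.
by rewrite /val_ball/= -valuationN opprB.
Qed.

Lemma val_entourage_split E : val_entourage E ->
  exists2 B, val_entourage B & (B \; B `<=` E)%relation.
Proof.
move=> [n nE]; exists (val_ball n); first by exists n.
move=> [x z] /= [y xy yz]; apply: nE.
by apply: le_trans (valuationB (x : K) y z); rewrite le_min; apply/andP.
Qed.

HB.instance Definition _ := isUniform.Build valued_space val_entourage_filter
  val_entourage_diagonal val_entourage_inv val_entourage_split.

Definition seq_cvg (u : nat -> K) : Prop := cvgn (u : nat -> valued_space).
Definition seq_lim (u : nat -> K) : K := limn (u : nat -> valued_space).

End ValuationTopology.

HB.mixin Record isLocalField K of DValField K := {
  valued_complete : forall F : set_system (valued_space K),
    ProperFilter F -> cauchy F -> cvg F;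
  residue_finite : finite_set [set: residue_field K]
}.

#[short(type="localFieldType")]
HB.structure Definition LocalField := {K of DValField K & isLocalField K}.

Definition is_square (K : fieldType) (x : K) : Prop := exists e, e ^+ 2 = x.

Section EdwardsCurves.
Variables (K : fieldType) (d : K).

Definition edwards_curve (P : K * K) : Prop :=
  P.1 ^+ 2 + P.2 ^+ 2 = 1 + d * P.1 ^+ 2 * P.2 ^+ 2.

(* Total on K * K only through the convention x / 0 = 0; on the curve and for
   d a non-square, the denominators do not vanish. *)
Definition edwards_add (P Q : K * K) : K * K :=
  ((P.1 * Q.2 + Q.1 * P.2) / (1 + d * P.1 * Q.1 * P.2 * Q.2),
   (P.2 * Q.2 - P.1 * Q.1) / (1 - d * P.1 * Q.1 * P.2 * Q.2)).

End EdwardsCurves.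

(* Absence of singular points on y^2 = x^3 + a2 x^2 + a4 x + a6, over any
   extension field; the point at infinity is always smooth. *)
Definition weierstrass_nonsingular (k : fieldType) (a2 a4 a6 : k) : Prop :=
  forall (L : fieldType) (f : {rmorphism k -> L}) (x y : L),
    ~ [/\ y ^+ 2 = x ^+ 3 + f a2 * x ^+ 2 + f a4 * x + f a6,
          2 * y = 0
        & 3 * x ^+ 2 + 2 * f a2 * x + f a4 = 0].

Section GoodReduction.
Variable K : dvalFieldType.

Definition edwards_good_reduction (d : K) : Prop :=
  exists2 D : integer_ring K, int_val D = d &
    reduction D * (reduction D - 1) != 0.

Definition weierstrass_good_reduction (a2 a4 a6 : K) : Prop :=
  exists A2 A4 A6 : integer_ring K,
    [/\ int_val A2 = a2, int_val A4 = a4, int_val A6 = a6 &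
        weierstrass_nonsingular (reduction A2) (reduction A4) (reduction A6)].

End GoodReduction.

Definition short_a (K : fieldType) (a' b' : K) : K := b' - a' ^+ 2 / 3.
Definition short_b (K : fieldType) (a' b' : K) : K :=
  2 * a' ^+ 3 / 27 - a' * b' / 3.

Section WeierstrassCoefficients.
Variables (K : fieldType) (g2 g3 : K).

(* The list c_0, ..., c_(n-1), with c_0 = c_1 = 0. *)
Fixpoint wp_coefs (n : nat) : seq K :=
  if n is k.+1 then
    let s := wp_coefs k in
    rcons s (match k with
             | 0 | 1 => 0
             | 2 => g2 / 20
             | 3 => g3 / 28
             | _ => 3 / ((2 * k + 1)%N%:R * (k - 3)%N%:R) *
                    \sum_(2 <= m < k.-1) s`_m * s`_(k - m)
             end)
  else [::].

Definition wp_coef (k : nat) : K := (wp_coefs k.+1)`_k.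

Lemma size_wp_coefs n : size (wp_coefs n) = n.
Proof. by elim: n => //= n IHn; rewrite size_rcons IHn. Qed.

Lemma nth_wp_coefs n k : (k < n)%N -> (wp_coefs n)`_k = wp_coef k.
Proof.
elim: n => // n IHn; rewrite ltnS leq_eqVlt => /predU1P[->//|kn].
by rewrite [wp_coefs _.+1]/= nth_rcons size_wp_coefs kn IHn.
Qed.

Lemma wp_coef2 : wp_coef 2 = g2 / 20. Proof. by []. Qed.

Lemma wp_coef3 : wp_coef 3 = g3 / 28. Proof. by []. Qed.

Lemma wp_coefE k : (4 <= k)%N ->
  wp_coef k = 3 / ((2 * k + 1)%N%:R * (k - 3)%N%:R) *
    \sum_(2 <= m < k.-1) wp_coef m * wp_coef (k - m).
Proof.
move=> k4; rewrite /wp_coef [wp_coefs _.+1]/= nth_rcons size_wp_coefs ltnn eqxx.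
case: k k4 => [|[|[|[|k]]]]// _; congr (_ * _).
apply: eq_big_nat => m /andP[m2 mk]; rewrite !nth_wp_coefs//.
  by rewrite ltn_subrL (leq_trans _ m2).
exact: leq_trans mk _.
Qed.

(* Since k ranges over all integers >= 4, this forces characteristic zero. *)
Definition wp_coef_defined : Prop :=
  [/\ 20 != 0 :> K, 28 != 0 :> K
    & forall k, (4 <= k)%N -> (2 * k + 1)%N%:R * (k - 3)%N%:R != 0 :> K].

End WeierstrassCoefficients.

Section WeierstrassFunction.
Variables (K : dvalFieldType) (g2 g3 : K).
Local Notation c := (wp_coef g2 g3).

Definition wp_partial (z : K) (n : nat) : K :=
  \sum_(2 <= k < n) c k * z ^+ (2 * k - 2).
Definition wp'_partial (z : K) (n : nat) : K :=
  \sum_(2 <= k < n) (2 * k - 2)%N%:R * c k * z ^+ (2 * k - 3).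

Definition wp (z : K) : K := z ^- 2 + seq_lim (wp_partial z).
Definition wp' (z : K) : K := - (2 / z ^+ 3) + seq_lim (wp'_partial z).

End WeierstrassFunction.

Definition edwards_exp (K : dvalFieldType) (g2 g3 a' x1 y1 z : K) : K * K :=
  let p := wp g2 g3 z in
  let p' := wp' g2 g3 z in
  if z == 0 then (0, 1) else
  (2 / 3 * (y1 * (3 * p - a') / (x1 * p')),
   (3 * p - a' - 3 * x1) / (3 * p - a' + 3 * x1)).

(* Main.v *)
From HB Require Import structures.
Require Import Defs.
From mathcomp Require Import all_boot all_order all_algebra.
From mathcomp Require Import boolp classical_sets constructive_ereal topology.
From mathcomp Require Import ring zify.
Import Order.TTheory GRing.Theory Num.Theory.
Set Implicit Arguments.
Unset Strict Implicit.
Unset Printing Implicit Defensive.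
Local Open Scope ring_scope.

(* For nonzero u and v in the maximal ideal, [wp (u s)], [wp (v s)] and
   [wp ((u + v) s)] are even Laurent series in one variable s. The chord (or
   tangent) construction applied to the first two yields a series with the same
   double pole as the third, satisfying the same first-order equation; such a
   solution is unique, so the addition theorem holds formally. Multiplied by
   s ^ 2 and s ^ 3, the series involved become power series in t = s ^ 2, which
   converge at t = 1 by hypothesis. Over a non-archimedean field evaluating at
   t = 1 is multiplicative, so the addition theorem holds for the values.

   As [wp] has no pole in the maximal ideal except 0, the duplication formula
   shows that [wp'] does not vanish there; [3 wp - a' + 3 x1] does not vanish
   because d is not a square. In the coordinates xi = (wp - a'/3) / x1 and
   eta = wp' / (2 y1), Exp is (xi / eta, (xi - 1) / (xi + 1)), and the Edwards
   addition follows from the relations between the coefficients of a line and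
   the three points of the curve on it. *)

(** * Formal power series *)

Section PowerSeries.
Variable R : comNzRingType.

(** The wrapper keeps the Cauchy product apart from pointwise operations on functions. *)
Record fps := Fps { fps_coef :> nat -> R }.

HB.instance Definition _ := [isNew for fps_coef].
HB.instance Definition _ := [Choice of fps by <:].

Implicit Types f g h : fps.

Lemma fpsP f g : (forall n, f n = g n) -> f = g.
Proof. by case: f g => [f] [g] /= e; congr Fps; apply: funext. Qed.

Definition fps_zero := Fps (fun=> 0).
Definition fps_add f g := Fps (fun n => f n + g n).
Definition fps_opp f := Fps (fun n => - f n).

Lemma fps_addA : associative fps_add.
Proof. by move=> f g h; apply: fpsP => n; rewrite /= addrA. Qed.
Lemma fps_addC : commutative fps_add.
Proof. by move=> f g; apply: fpsP => n; rewrite /= addrC. Qed.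
Lemma fps_add0 : left_id fps_zero fps_add.
Proof. by move=> f; apply: fpsP => n; rewrite /= add0r. Qed.
Lemma fps_addN : left_inverse fps_zero fps_opp fps_add.
Proof. by move=> f; apply: fpsP => n; rewrite /= addNr. Qed.

HB.instance Definition _ :=
  GRing.isZmodule.Build fps fps_addA fps_addC fps_add0 fps_addN.

Definition fpsC (c : R) := Fps (fun n => c *+ (n == 0)).
Definition fps_mul f g := Fps (fun n => \sum_(i < n.+1) f i * g (n - i)%N).

(** Coefficients of degree at most [n] of a product involve only these truncations, so associativity
    and commutativity are inherited from polynomials. *)
Definition fps_trunc n f : {poly R} := \poly_(i < n.+1) f i.

Lemma coef_fps_trunc n f k : (k <= n)%N -> (fps_trunc n f)`_k = f k.
Proof. by move=> kn; rewrite coef_poly ltnS kn. Qed.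

Lemma coefM_le (p p' q q' : {poly R}) n :
  (forall k, (k <= n)%N -> p`_k = p'`_k) ->
  (forall k, (k <= n)%N -> q`_k = q'`_k) -> (p * q)`_n = (p' * q')`_n.
Proof.
move=> pp' qq'; rewrite !coefM; apply: eq_bigr => i _.
by rewrite pp' ?qq' ?leq_subr// -ltnS.
Qed.

Lemma fps_mulE n f g k : (k <= n)%N ->
  fps_mul f g k = (fps_trunc n f * fps_trunc n g)`_k.
Proof.
move=> kn; rewrite coefM /=; apply: eq_bigr => i _.
by rewrite !coef_fps_trunc//; have := ltn_ord i; lia.
Qed.

Lemma fps_mulA : associative fps_mul.
Proof.
move=> f g h; apply: fpsP => n; rewrite !(@fps_mulE n)//.
transitivity ((fps_trunc n f * (fps_trunc n g * fps_trunc n h))`_n).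
  by apply: coefM_le => // k kn; rewrite coef_fps_trunc// (@fps_mulE n).
rewrite mulrA; apply: coefM_le => // k kn.
by rewrite [RHS]coef_fps_trunc// (@fps_mulE n).
Qed.

Lemma fps_mulC : commutative fps_mul.
Proof. by move=> f g; apply: fpsP => n; rewrite !(@fps_mulE n)// mulrC. Qed.

Lemma fps_mul_Cl c f n : fps_mul (fpsC c) f n = c * f n.
Proof.
rewrite /= big_ord_recl /= mulr1n subn0 big1 ?addr0// => i _.
by rewrite mulr0n mul0r.
Qed.

Lemma fps_mul1 : left_id (fpsC 1) fps_mul.
Proof. by move=> f; apply: fpsP => n; rewrite fps_mul_Cl mul1r. Qed.

Lemma fps_mulD : left_distributive fps_mul fps_add.
Proof.
move=> f g h; apply: fpsP => n /=; rewrite -big_split /=.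
by apply: eq_bigr => i _; rewrite mulrDl.
Qed.

Lemma fps_one_neq0 : fpsC 1 != 0.
Proof. by apply/eqP => /(congr1 (@^~ 0%N \o fps_coef))/eqP; rewrite /= oner_eq0. Qed.

HB.instance Definition _ := GRing.Zmodule_isComNzRing.Build fps
  fps_mulA fps_mulC fps_mul1 fps_mulD fps_one_neq0.

Lemma fps_coefD f g n : (f + g) n = f n + g n. Proof. by []. Qed.
Lemma fps_coefN f n : (- f) n = - f n. Proof. by []. Qed.
Lemma fps_coefB f g n : (f - g) n = f n - g n. Proof. by []. Qed.
Lemma fps_coef0 n : (0 : fps) n = 0. Proof. by []. Qed.
Lemma fps_coef1 n : (1 : fps) n = (n == 0)%:R. Proof. by []. Qed.
Lemma fps_coefC c n : fpsC c n = c *+ (n == 0). Proof. by []. Qed.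

Lemma fps_coefM f g n : (f * g) n = \sum_(i < n.+1) f i * g (n - i)%N.
Proof. by []. Qed.

Lemma fps_coefCM c f n : (fpsC c * f) n = c * f n.
Proof. exact: fps_mul_Cl. Qed.

Lemma fps_coefM0 f g : (f * g) 0%N = f 0%N * g 0%N.
Proof. by rewrite fps_coefM big_ord1. Qed.

Fact fpsC_additive : zmod_morphism fpsC.
Proof. by move=> x y; apply: fpsP => n; rewrite /= mulrnBl. Qed.
Fact fpsC_multiplicative : monoid_morphism fpsC.
Proof.
by split=> // x y; apply: fpsP => n; rewrite fps_coefCM /= mulrnAr.
Qed.
HB.instance Definition _ := GRing.isZmodMorphism.Build R fps fpsC fpsC_additive.
HB.instance Definition _ :=
  GRing.isMonoidMorphism.Build R fps fpsC fpsC_multiplicative.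

Lemma fps_coef_natM (k : nat) f n : (k%:R * f) n = k%:R * f n.
Proof. by rewrite -(rmorph_nat fpsC) fps_coefCM. Qed.

(** Both factors are divisible by [t ^ 2], so the product starts in degree 4. *)
Lemma fps_coefM_small f g n :
  f 0 = 0 -> f 1 = 0 -> g 0 = 0 -> g 1 = 0 -> (n <= 3)%N -> (f * g) n = 0.
Proof.
move=> f0 f1 g0 g1 n3; rewrite fps_coefM big1// => i _.
have [i1|i1] := leqP i 1.
  by case: (nat_of_ord i) i1 => [|[]]// _; rewrite ?f0 ?f1 mul0r.
have : (n - i <= 1)%N by lia.
by case: (n - i)%N => [|[]]// _; rewrite ?g0 ?g1 mulr0.
Qed.

Lemma fps_coefM_low f g n :
  (forall k, (k < n)%N -> f k = 0) -> (f * g) n = f n * g 0.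
Proof.
move=> f0; rewrite fps_coefM big_ord_recr /= subnn big1 ?add0r// => k _.
by rewrite f0 ?mul0r.
Qed.

Definition fpsX := Fps (fun n => (n == 1%N)%:R).

Lemma fps_coefXM f n : (fpsX * f) n = if n is m.+1 then f m else 0.
Proof.
rewrite fps_coefM; case: n => [|n]; first by rewrite big_ord1 mul0r.
rewrite big_ord_recl mul0r add0r big_ord_recl /= mul1r subn1 /=.
by rewrite big1 ?addr0// => i _; rewrite mul0r.
Qed.

Lemma fps_coefX2M f n : (fpsX ^+ 2 * f) n = if n is m.+2 then f m else 0.
Proof. by rewrite -mulrA fps_coefXM; case: n => // n; rewrite fps_coefXM. Qed.

Lemma fps_coefX2 n : (fpsX ^+ 2) n = (n == 2)%:R.
Proof.
by rewrite -[_ ^+ 2]mulr1 fps_coefX2M; case: n => [|[|[|n]]].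
Qed.

Lemma fps_coefX3 n : (fpsX ^+ 3) n = (n == 3)%:R.
Proof. by rewrite exprS fps_coefXM; case: n => // n; rewrite fps_coefX2. Qed.

(* Series in [t] stand for even series in [s], with [t = s ^+ 2]: this is the
   Euler derivation [s d/ds]. *)
Definition fps_euler f := Fps (fun n => (2 * n)%:R * f n).

Lemma fps_coef_euler f n : fps_euler f n = (2 * n)%:R * f n. Proof. by []. Qed.

Fact fps_euler_additive : zmod_morphism fps_euler.
Proof. by move=> f g; apply: fpsP => n; rewrite /= mulrBr. Qed.
HB.instance Definition _ :=
  GRing.isZmodMorphism.Build fps fps fps_euler fps_euler_additive.

Lemma fps_eulerM f g : fps_euler (f * g) = fps_euler f * g + f * fps_euler g.
Proof.
apply: fpsP => n; rewrite fps_coefD !fps_coefM /= mulr_sumr.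
rewrite -big_split /=; apply: eq_bigr => i _.
have -> : (2 * n)%N = (2 * i + 2 * (n - i))%N by have := ltn_ord i; lia.
by rewrite natrD; ring.
Qed.

Lemma fps_eulerC c : fps_euler (fpsC c) = 0.
Proof. by apply: fpsP => -[|n] /=; rewrite ?mul0r// mulr0n mulr0. Qed.

Lemma fps_euler_inv f i : f * i = 1 -> fps_euler i = - fps_euler f * i ^+ 2.
Proof.
move=> fi; have : fps_euler (f * i) = 0 by rewrite fi -(rmorph1 fpsC) fps_eulerC.
rewrite fps_eulerM => /(congr1 (fun u => u * i)); rewrite mul0r => e.
have -> : fps_euler i = f * i * fps_euler i by rewrite fi mul1r.
have -> : f * i * fps_euler i =
  (fps_euler f * i + f * fps_euler i) * i - fps_euler f * i ^+ 2 by ring.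
by rewrite e sub0r mulNr.
Qed.

Lemma fps_eulerX : fps_euler fpsX = 2 * fpsX.
Proof.
by rewrite mulr_natl; apply: fpsP => -[|[|n]] /=; rewrite ?mul0r ?mulr0 ?addr0 ?mulr1.
Qed.

(** The substitution of [c t] for [t]; this is why it is a ring morphism and commutes with
    [fps_euler]. *)
Definition fps_scale c f := Fps (fun n => c ^+ n * f n).

Fact fps_scale_additive c : zmod_morphism (fps_scale c).
Proof. by move=> f g; apply: fpsP => n; rewrite /= mulrBr. Qed.
Fact fps_scale_multiplicative c : monoid_morphism (fps_scale c).
Proof.
split=> [|f g]; apply: fpsP => n /=.
  by case: n => [|n]; rewrite ?mulr1// mulr0n mulr0.
rewrite mulr_sumr; apply: eq_bigr => i _.
by rewrite mulrACA -exprD subnKC// -ltnS.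
Qed.
HB.instance Definition _ c :=
  GRing.isZmodMorphism.Build fps fps (fps_scale c) (fps_scale_additive c).
HB.instance Definition _ c :=
  GRing.isMonoidMorphism.Build fps fps (fps_scale c) (fps_scale_multiplicative c).

Lemma fps_scaleC c x : fps_scale c (fpsC x) = fpsC x.
Proof. by apply: fpsP => -[|n] /=; rewrite ?mul1r// mulr0n mulr0. Qed.

Lemma fps_scaleX c : fps_scale c fpsX = fpsC c * fpsX.
Proof.
by apply: fpsP => n; rewrite fps_coefCM; case: n => [|[|n]] /=; rewrite ?mulr0.
Qed.

Lemma fps_scale_euler c f : fps_scale c (fps_euler f) = fps_euler (fps_scale c f).
Proof. by apply: fpsP => n /=; rewrite mulrCA. Qed.

End PowerSeries.

Section PowerSeriesField.
Variable K : fieldType.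
Implicit Types f g : fps K.

(** The first [n] coefficients of the inverse of [f]: the one of degree [k] is found by solving the
    degree [k] part of [f * g = 1]. *)
Fixpoint fps_inv_seq f n : seq K :=
  if n is k.+1 then
    let s := fps_inv_seq f k in
    rcons s (((k == 0)%:R - \sum_(i < k) f (k - i)%N * s`_i) / f 0%N)
  else [::].

Lemma size_fps_inv_seq f n : size (fps_inv_seq f n) = n.
Proof. by elim: n => //= n IHn; rewrite size_rcons IHn. Qed.

Lemma nth_fps_inv_seq f n k : (k < n)%N ->
  (fps_inv_seq f n)`_k = (fps_inv_seq f k.+1)`_k.
Proof.
elim: n => // n IHn; rewrite ltnS leq_eqVlt => /predU1P[->//|kn].
by rewrite [fps_inv_seq f n.+1]/= nth_rcons size_fps_inv_seq kn IHn.
Qed.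

Lemma fps_inv_ex f : f 0%N != 0 -> exists g, f * g = 1.
Proof.
move=> f0; exists (Fps (fun n => (fps_inv_seq f n.+1)`_n)).
apply: fpsP => n; rewrite fps_coef1 mulrC fps_coefM big_ord_recr /= subnn.
rewrite nth_rcons size_fps_inv_seq ltnn eqxx divfK// addrC.
rewrite [X in _ + X](_ : _ = \sum_(i < n) f (n - i)%N * (fps_inv_seq f n)`_i).
  by rewrite subrK.
by apply: eq_bigr => i _; rewrite mulrC -(@nth_fps_inv_seq f n).
Qed.

End PowerSeriesField.

(** * The Weierstrass series *)

(** The factor [k - 3] of the denominators runs through all positive integers, so the characteristic
    is 0. *)
Lemma wp_coef_defined_natr_neq0 (K : fieldType) n :
  wp_coef_defined K -> n.+1%:R != 0 :> K.
Proof.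
case=> _ _ /(_ (n + 4)%N); rewrite leq_addl => /(_ isT).
by rewrite mulf_eq0 negb_or => /andP[_]; have -> : (n + 4 - 3 = n.+1)%N by lia.
Qed.

Section FormalWeierstrass.
Variables (K : fieldType) (a b : K).
Hypothesis Kdef : wp_coef_defined K.
Local Notation c := (wp_coef (- 4 * a) (- 4 * b)).
Local Notation t := (fpsX K).
Local Notation E := (@fps_euler K).
Local Notation C := (@fpsC K).

Let natS_neq0 n : n.+1%:R != 0 :> K.
Proof. exact: wp_coef_defined_natr_neq0. Qed.

(** Multiplied by [s ^ 2], the term [c_k s ^ (2 k - 2)] of [wp] becomes [c_k t ^ k], and the pole
    becomes the constant 1 added in [wp_fps]. *)
Definition wp_tail : fps K := Fps c.
Definition wp_fps : fps K := 1 + wp_tail.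
(** This is [s ^ 3 wp'(s)], because [s d/ds] maps [s ^ 2 wp] to [2 s ^ 2 wp + s ^ 3 wp']. *)
Definition wp'_fps : fps K := E wp_fps - 2 * wp_fps.

Lemma wp_tailE n : wp_tail n = c n. Proof. by []. Qed.
Lemma wp_tail0 : wp_tail 0%N = 0. Proof. by []. Qed.
Lemma wp_tail1 : wp_tail 1%N = 0. Proof. by []. Qed.

Lemma wp'_fpsE n : wp'_fps n = ((2 * n)%:R - 2) * wp_fps n.
Proof. by rewrite fps_coefB fps_coef_natM /= mulrBl. Qed.

(** As [c 0] and [c 1] vanish, two terms drop out at each end of the convolution, which leaves the
    sum of the recursion for [c n]. *)
Lemma wp_tail_sqr n : (3 < n)%N ->
  (wp_tail ^+ 2) n = \sum_(2 <= m < n.-1) c m * c (n - m).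
Proof.
case: n => [|[|[|[|n]]]]// _; rewrite expr2 fps_coefM.
rewrite -(big_mkord predT (fun i => c i * c (n.+4 - i))).
rewrite big_ltn// big_ltn// [c 0]wp_tail0 [c 1]wp_tail1 !mul0r !add0r.
rewrite big_nat_recr//= big_nat_recr//= subnn subSn// subnn.
by rewrite [c 0]wp_tail0 [c 1]wp_tail1 !mulr0 !addr0.
Qed.

Definition wp'_tail : fps K := E wp_tail - 2 * wp_tail.

Lemma wp'_tailE n : wp'_tail n = ((2 * n)%:R - 2) * c n.
Proof. by rewrite fps_coefB fps_coef_natM fps_coef_euler mulrBl. Qed.

Lemma wp'_fps_tail : wp'_fps = wp'_tail - 2.
Proof.
rewrite /wp'_fps /wp'_tail /wp_fps raddfD /= -[X in E X](rmorph1 C) fps_eulerC.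
by ring.
Qed.

(* [wp'' = 6 * wp ^+ 2 + 2 * a]; the recursion defining the coefficients is
   this equation, except in degree 3. *)
Lemma wp_fps_ode2 :
  E wp'_fps = 3 * wp'_fps + 6 * wp_fps ^+ 2 + C (2 * a) * t ^+ 2.
Proof.
have EC k : E k%:R = 0 by rewrite -(rmorph_nat C) fps_eulerC.
suff tl : E wp'_tail =
    3 * wp'_tail + 12 * wp_tail + 6 * wp_tail ^+ 2 + C (2 * a) * t ^+ 2.
  by rewrite wp'_fps_tail raddfB /= (EC 2%N) tl /wp_fps; ring.
apply: fpsP => n; rewrite !fps_coefD !fps_coef_natM fps_coefCM fps_coefX2.
rewrite fps_coef_euler wp'_tailE wp_tailE.
have [n3|n3] := leqP n 3; last first.
  rewrite wp_tail_sqr// gtn_eqF ?mulr0 ?addr0; last exact: ltnW.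
  have n1 : 2 * n%:R + 1 != 0 :> K by rewrite -natrM natr1.
  have n2 : (n - 3)%:R != 0 :> K.
    by have -> : (n - 3 = (n - 4).+1)%N by lia.
  have := wp_coefE (- 4 * a) (- 4 * b) n3; set S := \sum_(_ <= _ < _) _.
  (* The equation multiplies [c n] by [2 n (2 n - 2) - 3 (2 n - 2) - 12 = 2 (2 n + 1) (n - 3)],
     twice the denominator in the recursion. *)
  move/(congr1 (fun x => 2 * ((2 * n + 1)%:R * (n - 3)%:R) * x)).
  rewrite [in RHS]mulrA [RHS](_ : _ = 6 * S); last first.
    by field; rewrite n2 n1.
  by move=> <-; rewrite natrB; [ring | exact: ltnW].
(* Below degree 4 the equation is linear in the tail. Degree 2 is the definition of [c 2]; in degree
   3 both sides equal [24 c 3], whatever [c 3] is. *)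
rewrite expr2 (@fps_coefM_small _ _ _ n)//.
have c2 : 10 * c 2%N = - 2 * a.
  by have n20 := natS_neq0 19; rewrite wp_coef2; field.
case: n n3 => [|[|[|[|]]]]// _ /=.
- by rewrite (_ : c 0 = 0)//; ring.
- by rewrite (_ : c 1 = 0)//; ring.
- by rewrite (_ : 2 * a = - (10 * c 2%N)); [ring | rewrite c2; ring].
- by ring.
Qed.

(** By [wp_fps_ode2], the difference [D] of the two sides satisfies [E D = 6 D]. Since [E]
    multiplies the degree [n] coefficient by [2 n], only degree 3 can survive, and there the value
    of [c 3] gives 0. *)
Lemma wp_fps_ode1 :
  wp'_fps ^+ 2 = 4 * wp_fps ^+ 3 + C (4 * a) * t ^+ 2 * wp_fps
                 + C (4 * b) * t ^+ 3.
Proof.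
pose D := wp'_fps ^+ 2 - 4 * wp_fps ^+ 3 - C (4 * a) * t ^+ 2 * wp_fps
  - C (4 * b) * t ^+ 3.
have EC k : E k%:R = 0 by rewrite -(rmorph_nat C) fps_eulerC.
have ED : E D = 6 * D.
  rewrite /D !raddfB /= !exprS !expr0 !mulr1 !fps_eulerM !fps_eulerC (EC 4).
  rewrite fps_eulerX wp_fps_ode2 -[E wp_fps](subrK (2 * wp_fps)) -/wp'_fps.
  rewrite !rmorphM /= !(rmorph_nat C).
  by ring.
suff D0 : D = 0.
  by apply/eqP; rewrite -subr_eq0 -D0 /D; apply/eqP; ring.
apply: fpsP => n; have : E D n = (6 * D) n by rewrite ED.
rewrite fps_coef_natM fps_coef_euler => /eqP.
rewrite -subr_eq0 -mulrBl mulf_eq0.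
have [->{n} _|n3] := eqVneq n 3%N; last first.
  suff /negPf -> : ((2 * n)%:R - 6 : K) != 0 by move/eqP.
  have [n3'|n3'] := leqP n 3.
    rewrite -oppr_eq0 opprB -natrB; last by lia.
    by have -> : (6 - 2 * n = (5 - 2 * n).+1)%N by lia.
  rewrite -natrB; last by lia.
  by have -> : (2 * n - 6 = (2 * n - 7).+1)%N by lia.
have c3 : 28 * c 3%N = - 4 * b.
  by have n28 := natS_neq0 27; rewrite wp_coef3; field.
have W0 : wp'_tail 0 = 0 by rewrite wp'_tailE (_ : c 0 = 0) ?mulr0.
have W1 : wp'_tail 1 = 0 by rewrite wp'_tailE (_ : c 1 = 0) ?mulr0.
(* Sorted by degree in the tails, so that all products of tails vanish in degree 3. *)
rewrite (_ : D = (- 4)%:~R * wp'_tail - 12 * wp_tail - C (4 * b) * t ^+ 3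
   + wp'_tail * wp'_tail - 12 * (wp_tail * wp_tail)
   - 4 * (wp_tail * wp_tail * wp_tail)
   - C (4 * a) * (t ^+ 2 * wp_fps)); last first.
  by rewrite /D wp'_fps_tail /wp_fps; ring.
rewrite -[(- 4)%:~R](rmorph_int C) !(fps_coefD, fps_coefN) !fps_coef_natM.
rewrite !fps_coefCM fps_coefX3 fps_coefX2M !fps_coefM_small//.
rewrite wp'_tailE wp_tailE.
rewrite [X in _ - 4 * a * X](_ : _ = 0); last by rewrite /= addr0.
rewrite (_ : 4 * b = - (28 * c 3%N)); last by rewrite c3; ring.
rewrite fps_coef0 eqxx mulr1.
by ring.
Qed.

(* [s ^+ 2 * wp (z s)] and [s ^+ 3 * wp' (z s)]. *)
Definition wp_fps_at z : fps K := C (z ^- 2) * fps_scale (z ^+ 2) wp_fps.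
Definition wp'_fps_at z : fps K := C (z ^- 3) * fps_scale (z ^+ 2) wp'_fps.

Lemma wp_fps_atE z n : wp_fps_at z n = z ^- 2 * (z ^+ 2) ^+ n * wp_fps n.
Proof. by rewrite fps_coefCM mulrA. Qed.

Lemma wp'_fps_atE z n : wp'_fps_at z n = z ^- 3 * (z ^+ 2) ^+ n * wp'_fps n.
Proof. by rewrite fps_coefCM mulrA. Qed.

Lemma wp_fps_at0 z : wp_fps_at z 0 = z ^- 2.
Proof. by rewrite wp_fps_atE /= expr0 addr0 !mulr1. Qed.

Lemma wp'_fps_at0 z : wp'_fps_at z 0 = - 2 * z ^- 3.
Proof.
by rewrite wp'_fps_atE wp'_fpsE /= muln0 addr0 expr0 !mulr1 sub0r mulrC.
Qed.

Section At.
Variable z : K.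
Hypothesis z0 : z != 0.
Let i := C z^-1.

Let CzV : C z * i = 1.
Proof. by rewrite -rmorphM /= divff. Qed.

Let CzVn n : C (z ^- n) = i ^+ n.
Proof. by rewrite -exprVn rmorphXn. Qed.

Lemma wp_fps_at_euler : E (wp_fps_at z) = 2 * wp_fps_at z + C z * wp'_fps_at z.
Proof.
have : E wp_fps = wp'_fps + 2 * wp_fps by rewrite subrK.
rewrite /wp_fps_at /wp'_fps_at; move: wp_fps wp'_fps => P Q EP.
rewrite fps_eulerM fps_eulerC -fps_scale_euler EP.
rewrite rmorphD rmorphM /= rmorph_nat !CzVn.
by ring: CzV.
Qed.

Lemma wp'_fps_at_euler : E (wp'_fps_at z) =
  3 * wp'_fps_at z + C z * (6 * wp_fps_at z ^+ 2 + C (2 * a) * t ^+ 2).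
Proof.
move: wp_fps_ode2; rewrite /wp_fps_at /wp'_fps_at.
move: wp_fps wp'_fps => P Q EQ.
rewrite fps_eulerM fps_eulerC -fps_scale_euler EQ.
rewrite !rmorphD !rmorphM /= ?rmorph_nat !fps_scaleC fps_scaleX.
rewrite !CzVn ?rmorphM /=.
by ring: CzV.
Qed.

Lemma wp_fps_at_curve : wp'_fps_at z ^+ 2 =
  4 * wp_fps_at z ^+ 3 + C (4 * a) * t ^+ 2 * wp_fps_at z + C (4 * b) * t ^+ 3.
Proof.
move: wp_fps_ode1; rewrite /wp_fps_at /wp'_fps_at.
move: wp_fps wp'_fps => P Q cQ.
rewrite exprMn -(rmorphXn (fps_scale (z ^+ 2))) /= cQ.
rewrite !rmorphD !rmorphM /= ?rmorph_nat !fps_scaleC fps_scaleX.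
rewrite !CzVn ?rmorphM /=.
by ring: CzV.
Qed.

End At.

(* The Laurent series with double pole [1 / (g s) ^+ 2] solving the Weierstrass
   equation is unique: the lowest coefficient [u] of the difference of two
   solutions, in degree [n], satisfies [(8 n + 4) u = 0]. *)
Lemma weierstrass_ode_unique g (X Y X' Y' : fps K) : g != 0 ->
  X 0 = g ^- 2 -> X' 0 = g ^- 2 ->
  E X = 2 * X + C g * Y -> E X' = 2 * X' + C g * Y' ->
  Y ^+ 2 = 4 * X ^+ 3 + C (4 * a) * t ^+ 2 * X + C (4 * b) * t ^+ 3 ->
  Y' ^+ 2 = 4 * X' ^+ 3 + C (4 * a) * t ^+ 2 * X' + C (4 * b) * t ^+ 3 ->
  X = X' /\ Y = Y'.
Proof.
move=> g0 X0 X'0 EX EX' cX cX'.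
(* By the differential equations, [V = g (Y - Y')] and [S = g (Y + Y')]; hence [V * S] is computed
   by the two curve equations. *)
pose V := E (X - X') - 2 * (X - X').
pose S := E (X + X') - 2 * (X + X').
have VS : V * S = (X - X') * (C (g ^+ 2) *
    (4 * (X ^+ 2 + X * X' + X' ^+ 2) + C (4 * a) * t ^+ 2)).
  transitivity (C g ^+ 2 * (Y ^+ 2 - Y' ^+ 2)).
    by rewrite /V /S raddfB raddfD /= EX EX'; ring.
  by rewrite cX cX' rmorphXn /=; ring.
have S0 : S 0 = - 4 * g ^- 2.
  by rewrite fps_coefB fps_coef_natM fps_coef_euler fps_coefD X0 X'0; ring.
have VE k : V k = ((2 * k)%:R - 2) * (X - X') k.
  by rewrite [LHS]fps_coefB fps_coef_natM fps_coef_euler mulrBl.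
clearbody S V.
have XX' : X = X'.
  apply: fpsP; elim/ltn_ind => n IH; apply/eqP; rewrite -subr_eq0 -fps_coefB.
  have U0 k : (k < n)%N -> (X - X') k = 0.
    by move=> /IH e; rewrite fps_coefB e subrr.
  have : (V * S) n = V n * S 0.
    by apply: fps_coefM_low => k /U0 e; rewrite VE e mulr0.
  rewrite VS (fps_coefM_low _ U0) VE S0; set u := (X - X') n.
  rewrite fps_coefCM fps_coefD fps_coef_natM fps_coefCM fps_coefX2 mulr0 addr0.
  rewrite !fps_coefD !expr2 !fps_coefM0 X0 X'0 => e.
  suff : (8 * n + 4)%:R * u == 0.
    by rewrite mulf_eq0 addnS (negPf (natS_neq0 _)).
  apply/eqP; have g20 : g ^- 2 != 0 by rewrite invr_eq0 expf_neq0.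
  apply: (mulfI g20); rewrite mulr0.
  have := e; move/eqP; rewrite -subr_eq0 => /eqP <-; rewrite natrD !natrM.
  by field.
split=> //; have gV : C g^-1 * C g = 1 by rewrite -rmorphM /= mulVf.
rewrite -[Y]mul1r -[Y']mul1r -gV -!mulrA; congr (_ * _).
by apply: (addrI (2 * X)); rewrite {2}XX' -EX -EX' XX'.
Qed.

End FormalWeierstrass.

(** * The formal addition theorem *)

Section Chord.
Variables (R : comNzRingType) (x y h k i p r : R).
Hypotheses (Di : (x - y) * i = 1) (ch : h ^+ 2 = x ^+ 3 + p * x + r)
  (ck : k ^+ 2 = y ^+ 3 + p * y + r).
Let l := (h - k) * i.

Lemma chord_param : [/\ h = k + l * (x - y),
   p = l * (h + k) - x ^+ 2 - x * y - y ^+ 2 & r = k ^+ 2 - y ^+ 3 - p * y].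
Proof.
split; last by rewrite ck; ring.
  have -> : k + l * (x - y) = k + (h - k) * ((x - y) * i) by rewrite /l; ring.
  by rewrite Di; ring.
have -> : l * (h + k) = (h ^+ 2 - k ^+ 2) * i by rewrite /l; ring.
rewrite ch ck; apply/eqP; rewrite -subr_eq0; apply/eqP.
transitivity ((x ^+ 2 + x * y + y ^+ 2 + p) * (1 - (x - y) * i)); first by ring.
by rewrite Di subrr mulr0.
Qed.

(* The left-hand side is the derivative of the slope [l] when [A] and [B] are
   the speeds at which the two points move along the curve. *)
Lemma chord_slope_derivative A B :
  (3 * h + A * (3 * x ^+ 2 + p) - 3 * k - B * (3 * y ^+ 2 + p)) * i
  - (h - k) * (2 * x + 2 * A * h - 2 * y - 2 * B * k) * i ^+ 2
  = l + A * (2 * x + y - l ^+ 2) + B * (x + 2 * y - l ^+ 2).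
Proof.
have [eh ep _] := chord_param.
transitivity ((x - y) * i *
    (l + A * (2 * x + y - l ^+ 2) + B * (x + 2 * y - l ^+ 2))); last first.
  by rewrite Di mul1r.
have -> : (h - k) * (2 * x + 2 * A * h - 2 * y - 2 * B * k) * i ^+ 2 =
   l * (2 * x + 2 * A * h - 2 * y - 2 * B * k) * i by rewrite /l; ring.
rewrite -mulrBl [RHS]mulrAC; congr (_ * i).
by move: l eh ep => m -> ->; ring.
Qed.

(** The third intersection of the chord with the curve has abscissa [l ^ 2 - x - y], and the
    left-hand base is the ordinate of the chord there. *)
Lemma chord_curve :
  (h + l * (l ^+ 2 - x - y - x)) ^+ 2 =
  (l ^+ 2 - x - y) ^+ 3 + p * (l ^+ 2 - x - y) + r.
Proof.
have [eh ep er] := chord_param.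
by rewrite er ep; move: l eh => m ->; ring.
Qed.

End Chord.

Section Tangent.
Variables (R : comNzRingType) (x h i p r : R).
Hypotheses (Di : 2 * h * i = 1) (ch : h ^+ 2 = x ^+ 3 + p * x + r).
Let l := (3 * x ^+ 2 + p) * i.

Lemma tangent_param : p = 2 * l * h - 3 * x ^+ 2.
Proof.
have -> : 2 * l * h = (3 * x ^+ 2 + p) * (2 * h * i) by rewrite /l; ring.
by rewrite Di; ring.
Qed.

(** The counterpart of [chord_slope_derivative]. The term [4 p] is the derivative of [p], which
    stands for [a t ^ 2]. *)
Lemma tangent_slope_derivative A :
  (6 * x * (2 * x + 2 * A * h) + 4 * p) * i
  - (3 * x ^+ 2 + p) * (2 * (3 * h + A * (3 * x ^+ 2 + p))) * i ^+ 2
  = l + 2 * A * (3 * x - l ^+ 2).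
Proof.
have ep := tangent_param.
transitivity ((2 * h * i) * (l + 2 * A * (3 * x - l ^+ 2))); last first.
  by rewrite Di mul1r.
have -> : (3 * x ^+ 2 + p) * (2 * (3 * h + A * (3 * x ^+ 2 + p))) * i ^+ 2 =
   l * (2 * (3 * h + A * (3 * x ^+ 2 + p))) * i by rewrite /l; ring.
rewrite -mulrBl [RHS]mulrAC; congr (_ * i).
by move: l ep => m ->; ring.
Qed.

Lemma tangent_curve :
  (h + l * (l ^+ 2 - 2 * x - x)) ^+ 2 =
  (l ^+ 2 - 2 * x) ^+ 3 + p * (l ^+ 2 - 2 * x) + r.
Proof.
have -> : r = h ^+ 2 - x ^+ 3 - p * x by rewrite ch; ring.
by move: l tangent_param => m ->; ring.
Qed.

End Tangent.

Section FormalAddition.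
Variables (K : fieldType) (a b : K).
Hypothesis Kdef : wp_coef_defined K.
Local Notation t := (fpsX K).
Local Notation E := (@fps_euler K).
Local Notation C := (@fpsC K).
Local Notation w := (wp_fps_at a b).
Local Notation w' := (wp'_fps_at a b).

Let natS_neq0 n : n.+1%:R != 0 :> K.
Proof. exact: wp_coef_defined_natr_neq0. Qed.

(** Halving makes the cubic monic, as the chord and tangent formulas require. *)
Definition half_wp'_fps_at z : fps K := C 2^-1 * w' z.
Local Notation h := half_wp'_fps_at.
Let p := C a * t ^+ 2.
Let r := C b * t ^+ 3.

Lemma fpsC_half : 2 * C 2^-1 = 1.
Proof. by rewrite -(rmorph_nat C) -rmorphM /= divff ?rmorph1. Qed.

Lemma wp'_fps_at_half z : w' z = 2 * h z.
Proof. by rewrite mulrA fpsC_half mul1r. Qed.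

Lemma half_wp'_fps_at0 z : h z 0 = - z ^- 3.
Proof. by rewrite fps_coefCM wp'_fps_at0 mulrA mulrN mulVf // mulN1r. Qed.

Lemma half_wp'_fps_at_curve z : z != 0 -> h z ^+ 2 = w z ^+ 3 + p * w z + r.
Proof.
move=> z0; rewrite exprMn wp_fps_at_curve// !rmorphM /= rmorph_nat /p /r.
have := fpsC_half; move: (w z) (C _) (C a) (C b) t => x q A B T e.
transitivity ((2 * q) ^+ 2 * (x ^+ 3 + A * T ^+ 2 * x + B * T ^+ 3)).
  by ring.
by rewrite e expr1n mul1r.
Qed.

Lemma wp_fps_at_euler_half z : z != 0 -> E (w z) = 2 * w z + 2 * C z * h z.
Proof.
by move=> z0; rewrite wp_fps_at_euler// wp'_fps_at_half; ring.
Qed.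

Lemma half_wp'_fps_at_euler z : z != 0 ->
  E (h z) = 3 * h z + C z * (3 * w z ^+ 2 + p).
Proof.
move=> z0; rewrite fps_eulerM fps_eulerC wp'_fps_at_euler// /h /p.
rewrite rmorphM /= rmorph_nat.
have := fpsC_half; move: (w z) (C _) (w' z) (C a) (C z) t => x q y A Z T e.
transitivity (3 * (q * y) + 2 * q * (Z * (3 * x ^+ 2 + A * T ^+ 2))).
  by ring.
by rewrite e mul1r.
Qed.

Lemma wp_fps_at_unique g (X H : fps K) : g != 0 -> X 0 = g ^- 2 ->
  E X = 2 * X + 2 * C g * H -> H ^+ 2 = X ^+ 3 + p * X + r ->
  w g = X /\ h g = H.
Proof.
move=> g0 X0 EX cH.
have [] := @weierstrass_ode_unique K a b Kdef g (w g) (w' g) X (2 * H).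
- by [].
- exact: wp_fps_at0.
- by [].
- exact: wp_fps_at_euler.
- by rewrite EX; ring.
- exact: wp_fps_at_curve.
- by rewrite exprMn cH /p /r !rmorphM /= rmorph_nat; ring.
by move=> -> e; split=> //; rewrite /h e mulrA [C _ * 2]mulrC fpsC_half mul1r.
Qed.

(** The formal addition theorem. Denominators are cleared so that it can be evaluated at [t = 1],
    where the value of the invertible series [w u - w v] might vanish. *)
Lemma wp_fps_chord (u v : K) : u != 0 -> v != 0 -> u + v != 0 -> u - v != 0 ->
  (w u - w v) ^+ 2 * (w (u + v) + w u + w v) = (h u - h v) ^+ 2 /\
  (w u - w v) * (h (u + v) + h u) + (h u - h v) * (w (u + v) - w u) = 0.
Proof.
move=> u0 v0 uv0 uv0'.
have D0 : u ^- 2 - v ^- 2 != 0.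
  have -> : u ^- 2 - v ^- 2 = - (u ^- 2 * v ^- 2 * ((u + v) * (u - v))).
    by field; rewrite u0 v0.
  by rewrite oppr_eq0 !mulf_neq0 ?invr_eq0 ?expf_neq0.
have [i Di] : exists i, (w u - w v) * i = 1.
  by apply: fps_inv_ex; rewrite fps_coefB !wp_fps_at0.
have i0 : i 0 = (u ^- 2 - v ^- 2)^-1.
  apply: (mulfI D0); rewrite divff// -!(wp_fps_at0 a b) -fps_coefB -fps_coefM0.
  by rewrite Di.
have cu := half_wp'_fps_at_curve u0; have cv := half_wp'_fps_at_curve v0.
pose l := (h u - h v) * i.
pose X := l ^+ 2 - w u - w v.
(* The two points move along the curve with speeds [u] and [v]. *)
have El : E l = l + C u * (2 * w u + w v - l ^+ 2) + C v * (w u + 2 * w v - l ^+ 2).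
  rewrite -(chord_slope_derivative Di cu cv) fps_eulerM (fps_euler_inv Di).
  rewrite !raddfB /= !wp_fps_at_euler_half// !half_wp'_fps_at_euler//.
  by ring.
have [] := @wp_fps_at_unique (u + v) X (- (h u + l * (X - w u))).
- by [].
- rewrite /X !fps_coefB !wp_fps_at0 [l ^+ 2]expr2 !fps_coefM0 fps_coefB.
  rewrite !half_wp'_fps_at0 i0.
  have : v ^+ 2 - u ^+ 2 != 0 by rewrite -oppr_eq0 opprB subr_sqr mulf_neq0.
  by move=> vu0; field; rewrite uv0 v0 u0 mulN1r.
- rewrite /X !raddfB /= expr2 fps_eulerM El !wp_fps_at_euler_half// rmorphD /=.
  have [eh _ _] := chord_param Di cu cv.
  clear X; rewrite -/l in eh; clearbody l.
  by rewrite eh; ring.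
- by rewrite sqrrN; exact: chord_curve Di cu cv.
move=> -> ->; have lD : l * (w u - w v) = h u - h v.
  by rewrite -mulrA [i * _]mulrC Di mulr1.
by rewrite -lD /X; split; ring.
Qed.

Lemma wp_fps_tangent (u : K) : u != 0 ->
  4 * h u ^+ 2 * (w (2 * u) + 2 * w u) = (3 * w u ^+ 2 + p) ^+ 2 /\
  2 * h u * (h (2 * u) + h u) + (3 * w u ^+ 2 + p) * (w (2 * u) - w u) = 0.
Proof.
move=> u0.
have D0 : 2 * - u ^- 3 != 0 :> K.
  by rewrite mulf_neq0 ?oppr_eq0 ?invr_eq0 ?expf_neq0.
have [i Di] : exists i, 2 * h u * i = 1.
  by apply: fps_inv_ex; rewrite fps_coef_natM half_wp'_fps_at0.
have i0 : i 0 = (2 * - u ^- 3)^-1.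
  apply: (mulfI D0); rewrite divff// -half_wp'_fps_at0 -fps_coef_natM -fps_coefM0.
  by rewrite Di.
have cu := half_wp'_fps_at_curve u0.
pose l := (3 * w u ^+ 2 + p) * i.
pose X := l ^+ 2 - 2 * w u.
have Ep : E p = 4 * p.
  by rewrite /p expr2 !fps_eulerM fps_eulerC !fps_eulerX; ring.
have EN k f : E (k%:R * f) = k%:R * E f :> fps K.
  by rewrite !mulr_natl raddfMn.
have El : E l = l + 2 * C u * (3 * w u - l ^+ 2).
  rewrite -(@tangent_slope_derivative _ (w u) (h u) i p Di) fps_eulerM.
  rewrite (fps_euler_inv Di).
  rewrite raddfD /= !EN Ep expr2 fps_eulerM.
  rewrite wp_fps_at_euler_half// half_wp'_fps_at_euler//.
  by ring.
have [] := @wp_fps_at_unique (2 * u) X (- (h u + l * (X - w u))).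
- by rewrite mulf_neq0.
- rewrite /X fps_coefB fps_coef_natM wp_fps_at0 [l ^+ 2]expr2 !fps_coefM0.
  have p0 : p 0 = 0 by rewrite fps_coefCM fps_coefX2 mulr0.
  rewrite fps_coefD p0 fps_coef_natM [w u ^+ 2]expr2 fps_coefM0 wp_fps_at0 i0 addr0.
  by field; rewrite u0 oppr_eq0 natS_neq0.
- rewrite /X raddfB /= EN expr2 fps_eulerM El wp_fps_at_euler_half// rmorphM /=.
  have ep := @tangent_param _ (w u) (h u) i p Di.
  by rewrite rmorph_nat; clear X; clearbody l; ring.
- by rewrite sqrrN; exact: (tangent_curve Di cu).
move=> -> ->; have lD : 3 * w u ^+ 2 + p = l * (2 * h u).
  by rewrite -mulrA [i * _]mulrC Di mulr1.
by rewrite lD /X; split; ring.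
Qed.

End FormalAddition.

(** * Evaluation of convergent series *)

Section Evaluation.
Variable K : dvalFieldType.
Local Notation v := (@valuation K).
Local Notation t := (fpsX K).
Local Notation C := (@fpsC K).

Lemma valuation_lb (x : K) : exists m : int, (m%:E <= v x)%E.
Proof.
have [->|x0] := eqVneq x 0; first by exists 0; rewrite valuation0 leey.
have := valuationV x0; case: (v x) => [m _| _|]; first by exists m.
  by exists 0; rewrite leey.
by rewrite addNye.
Qed.

Lemma valuation_ge_eq0 (x : K) : (forall m : int, (m%:E <= v x)%E) -> x = 0.
Proof.
move=> vx; apply/eqP; rewrite -valuation_eqoo.
case: (v x) vx => [k|//|] vx; last by have := vx 0.
by have := vx (k + 1); rewrite lee_fin gerDl.
Qed.

Lemma valuation_geD (m : int) (x y : K) :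
  (m%:E <= v x -> m%:E <= v y -> m%:E <= v (x + y)%R)%E.
Proof. by move=> vx vy; apply: le_trans (valuationD x y); rewrite le_min vx. Qed.

Lemma valuation_geM (m k : int) (x y : K) :
  (m%:E <= v x -> k%:E <= v y -> (m + k)%:E <= v (x * y)%R)%E.
Proof. by move=> vx vy; rewrite valuationM EFinD leeD. Qed.

Definition null_seq (f : nat -> K) :=
  forall m : int, exists N, forall n, (N <= n)%N -> (m%:E <= v (f n))%E.

Lemma null_seq_lb f : null_seq f -> exists m : int, forall n, (m%:E <= v (f n))%E.
Proof.
move=> /(_ 0)[N]; move: (0 : int); elim: N => [|N IH] m fN.
  by exists m => n; apply: fN.
have [k fk] := valuation_lb (f N); apply: (IH (Order.min m k)) => n.
rewrite leq_eqVlt => /predU1P[<-|Nn].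
  by apply: le_trans fk; rewrite lee_fin ge_min lexx orbT.
by apply: le_trans (fN _ Nn); rewrite lee_fin ge_min lexx.
Qed.

Lemma null_seqC c : null_seq (C c).
Proof. by move=> m; exists 1%N => -[|n]// _; rewrite valuation0 leey. Qed.

Lemma null_seqD (f g : fps K) : null_seq f -> null_seq g -> null_seq (f + g).
Proof.
move=> f0 g0 m; have [[N fN] [M gM]] := (f0 m, g0 m); exists (maxn N M) => n.
by rewrite geq_max => /andP[nN nM]; apply: valuation_geD; [apply: fN|apply: gM].
Qed.

(** In each term of a high coefficient one of the two indices is large while the other factor is
    bounded; by the ultrametric inequality the number of terms is irrelevant. *)
Lemma null_seqM (f g : fps K) : null_seq f -> null_seq g -> null_seq (f * g).
Proof.
move=> f0 g0 m; have [[k fk] [l gl]] := (null_seq_lb f0, null_seq_lb g0).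
have [[N fN] [M gM]] := (f0 (m - l), g0 (m - k)); exists (N + M)%N => n NMn.
rewrite fps_coefM; apply: (big_ind (fun x => m%:E <= v x)%E) => [|x y|i _].
- by rewrite valuation0 leey.
- exact: valuation_geD.
have [Ni|iN] := leqP N i.
  by rewrite -(subrK l m); apply: valuation_geM; [apply: fN | apply: gl].
rewrite -(subrKC k m); apply: valuation_geM; first exact: fk.
by apply: gM; lia.
Qed.

(* A series sums to [l] iff it is [l + (1 - t) F], [F] being the sequence of
   differences between its partial sums and [l]; multiplicativity is then
   immediate from [null_seqM]. *)
Definition sums (f : fps K) (l : K) :=
  exists2 F : fps K, null_seq F & f = C l + (1 - t) * F.

Lemma sumsC c : sums (C c) c.
Proof. by exists (C 0); [exact: null_seqC | rewrite rmorph0 mulr0 addr0]. Qed.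

Lemma sums_nat n : sums n%:R n%:R.
Proof. by rewrite -(rmorph_nat C); exact: sumsC. Qed.

Lemma sumsX : sums t 1.
Proof.
by exists (C (- 1)); [exact: null_seqC | rewrite rmorphN !rmorph1; ring].
Qed.

Lemma sumsD f g x y : sums f x -> sums g y -> sums (f + g) (x + y).
Proof.
move=> [F F0 ->] [G G0 ->]; exists (F + G); first exact: null_seqD.
by rewrite rmorphD /=; ring.
Qed.

Lemma sumsM f g x y : sums f x -> sums g y -> sums (f * g) (x * y).
Proof.
move=> [F F0 ->] [G G0 ->].
(* The cofactor of [1 - t] in the expanded product; [1 - t] itself is spelled out with constants so
   that the closure lemmas for null sequences apply. *)
exists (C x * G + C y * F + (C 1 + C (- 1) * t) * (F * G)).
  by do ![apply: null_seqD | apply: null_seqM | apply: null_seqC | by []] => m;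
    exists 2%N => -[|[|n]]// _; rewrite valuation0 leey.
by rewrite rmorphM /= rmorphN !rmorph1; ring.
Qed.

Lemma sumsN f x : sums f x -> sums (- f) (- x).
Proof.
move=> fx; rewrite -mulN1r -[- x]mulN1r -(rmorph1 C) -rmorphN.
by apply: sumsM fx; exact: sumsC.
Qed.

Lemma sumsB f g x y : sums f x -> sums g y -> sums (f - g) (x - y).
Proof. by move=> fx gy; apply: sumsD fx _; exact: sumsN. Qed.

Lemma sumsXn f x n : sums f x -> sums (f ^+ n) (x ^+ n).
Proof.
move=> fx; elim: n => [|n IH]; first exact: (sums_nat 1).
by rewrite !exprS; exact: sumsM.
Qed.

(** Subtracting gives [0 = (x - y) + (1 - t) F], which makes [F] the constant sequence [y - x];
    being null, it is 0. *)
Lemma sums_unique f x y : sums f x -> sums f y -> x = y.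
Proof.
move=> fx fy; have [F F0] := sumsB fx fy.
rewrite subrr => e; apply/eqP; rewrite -subr_eq0; apply/eqP.
have Fx n : F n = - (x - y).
  have en k : 0 = C (x - y) k + (F k - (t * F) k).
    by rewrite -[LHS](fps_coef0 K k) e fps_coefD mulrBl mul1r fps_coefB.
  elim: n => [|n IH].
    by have := en 0%N; rewrite fps_coefXM fps_coefC mulr1n subr0 => /eqP;
       rewrite eq_sym addr_eq0 => /eqP ->; rewrite opprK.
  by have := en n.+1; rewrite fps_coefXM fps_coefC mulr0n add0r => /eqP;
     rewrite eq_sym subr_eq0 => /eqP ->.
apply: valuation_ge_eq0 => m; have [N /(_ N (leqnn N))] := F0 m.
by rewrite Fx valuationN.
Qed.

Lemma seq_cvg_null (u : nat -> K) : seq_cvg u -> null_seq (fun n => u n - seq_lim u).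
Proof.
move=> /cvg_app_entourageP cu m.
have /cu [N _ uN] : entourage (val_ball m : set (valued_space K * valued_space K)).
  by exists m.
exists N => n /uN; rewrite /val_ball /= => h.
by rewrite -valuationN opprB.
Qed.

Lemma sums_partial (f : fps K) (S : nat -> K) l :
  (forall n, S n.+1 = S n + f n) -> S 0%N = 0 ->
  null_seq (fun n => S n - l) -> sums f l.
Proof.
(* [S n] sums the coefficients of degree below [n], whence the shift: in degree 0 the equation is
   [f 0 = l + F 0]. *)
move=> SS S0 Sl; exists (Fps (fun n => S n.+1 - l)).
  by move=> m; have [N SN] := Sl m; exists N => n Nn; apply: SN; exact: leqW.
apply: fpsP => n; rewrite fps_coefD mulrBl mul1r fps_coefB fps_coefXM fps_coefC.
case: n => [|n] /=; rewrite SS; first by rewrite S0; ring.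
by rewrite SS; ring.
Qed.

End Evaluation.

Section WeierstrassValues.
Variables (K : dvalFieldType) (a b : K).
Local Notation g2 := (- 4 * a).
Local Notation g3 := (- 4 * b).
Local Notation c := (wp_coef g2 g3).
Local Notation v := (@valuation K).

Lemma sums_wp z : z != 0 -> seq_cvg (wp_partial g2 g3 z) ->
  sums (wp_fps_at a b z) (wp g2 g3 z).
Proof.
move=> z0 /seq_cvg_null cz.
(* The pole is the coefficient of degree 0, so it enters every partial sum except the empty one. *)
apply: (@sums_partial _ _ (fun n => (n != 0)%:R * z ^- 2 + wp_partial g2 g3 z n)).
- case=> [|[|n]].
  + by rewrite wp_fps_at0 /wp_partial !big_geq//=; ring.
  + by rewrite wp_fps_atE /wp_partial !big_geq//= add0r (_ : c 1 = 0)//; ring.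
  rewrite wp_fps_atE /wp_partial big_nat_recr//= add0r addrA; congr (_ + _).
  rewrite mulrC; congr (_ * _).
  rewrite -exprM; have -> : (2 * n.+2 = 2 + (2 * n.+2 - 2))%N by lia.
  by rewrite exprD mulKf ?expf_neq0// addKn.
- by rewrite /wp_partial big_geq// mul0r addr0.
move=> m; have [N cN] := cz m; exists N.+1 => -[|n]// Nn.
rewrite /wp [X in v X](_ : _ =
  wp_partial g2 g3 z n.+1 - seq_lim (wp_partial g2 g3 z)).
  by apply: cN; exact: ltnW.
by rewrite mul1r; ring.
Qed.

Lemma sums_wp' z : z != 0 -> seq_cvg (wp'_partial g2 g3 z) ->
  sums (wp'_fps_at a b z) (wp' g2 g3 z).
Proof.
move=> z0 /seq_cvg_null cz.
apply: (@sums_partial _ _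
  (fun n => (n != 0)%:R * - (2 / z ^+ 3) + wp'_partial g2 g3 z n)).
- case=> [|[|n]].
  + by rewrite wp'_fps_at0 /wp'_partial !big_geq//=; ring.
  + by rewrite wp'_fps_atE wp'_fpsE /wp'_partial !big_geq//= add0r (_ : c 1 = 0)//; ring.
  rewrite wp'_fps_atE wp'_fpsE /wp'_partial big_nat_recr//= add0r addrA; congr (_ + _).
  rewrite natrB// [RHS]mulrC; congr (_ * _).
  rewrite -exprM.
  have -> : (2 * n.+2 = 3 + (2 * n.+2 - 3))%N by lia.
  by rewrite exprD mulKf ?expf_neq0// addKn.
- by rewrite /wp'_partial big_geq// mul0r addr0.
move=> m; have [N cN] := cz m; exists N.+1 => -[|n]// Nn.
rewrite /wp' [X in v X](_ : _ =
  wp'_partial g2 g3 z n.+1 - seq_lim (wp'_partial g2 g3 z)).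
  by apply: cN; exact: ltnW.
by rewrite mul1r; ring.
Qed.

End WeierstrassValues.

(** * Edwards curves *)

Section EdwardsComplete.
Variables (K : fieldType) (d : K).
Hypotheses (K2 : 2 != 0 :> K) (dns : ~ is_square d).

(* Bernstein and Lange: if [d x1 x2 y1 y2 = eps = 1] or [-1], then
   [(x1 + eps s y1) ^+ 2 = d (x1 y1 (x2 + s y2)) ^+ 2] for [s = 1] and [-1]. *)
Lemma edwards_complete (P Q : K * K) (eps : K) : eps ^+ 2 = 1 ->
  edwards_curve d P -> edwards_curve d Q ->
  d * P.1 * Q.1 * P.2 * Q.2 != eps.
Proof.
case: P Q => [x1 y1] [x2 y2] /=; rewrite /edwards_curve /= => e2 cP cQ.
apply/eqP => E.
have e0 : eps != 0.
  by apply/eqP => e0; move/eqP: e2; rewrite e0 expr0n eq_sym oner_eq0.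
have nz : [/\ x1 != 0, y1 != 0 & x2 != 0].
  by move: e0; rewrite -E !mulf_eq0 !negb_or => /andP[/andP[/andP[/andP[_ ->] ->] ->]].
have [x10 y10 x20] := nz.
have sq s : s ^+ 2 = 1 -> x2 + s * y2 = 0.
  move=> s2; apply/eqP/negP => /negP n0; apply: dns.
  exists ((x1 + eps * s * y1) / (x1 * y1 * (x2 + s * y2))).
  rewrite expr_div_n; apply: (canLR (mulfK _)).
    by rewrite expf_neq0// !mulf_neq0.
  transitivity (x1 ^+ 2 + y1 ^+ 2 * (eps ^+ 2 * s ^+ 2) + 2 * s * x1 * y1 * eps).
    by ring.
  rewrite e2 s2 !mulr1 cP -{1}e2 -{1 2}E.
  transitivity (d * (x1 * y1) ^+ 2 * (1 + d * x2 ^+ 2 * y2 ^+ 2) +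
     d * (x1 * y1) ^+ 2 * (2 * s * x2 * y2)); first by ring.
  have y2s : y2 ^+ 2 = s ^+ 2 * y2 ^+ 2 by rewrite s2 mul1r.
  by rewrite -cQ y2s; ring.
(* The two signs give [x2 + y2 = 0] and [x2 - y2 = 0], hence [2 x2 = 0], a contradiction. *)
have := sq 1 (expr1n _ _); have := sq (-1) (etrans (sqrrN _) (expr1n _ _)).
rewrite mulN1r mul1r => /eqP; rewrite subr_eq0 => /eqP <-.
by rewrite -mulr2n -mulr_natl => /eqP; rewrite mulf_eq0 (negPf K2) (negPf x20).
Qed.

Lemma edwards_add_denominators (P Q : K * K) :
  edwards_curve d P -> edwards_curve d Q ->
  1 + d * P.1 * Q.1 * P.2 * Q.2 != 0 /\ 1 - d * P.1 * Q.1 * P.2 * Q.2 != 0.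
Proof.
move=> cP cQ; split; last first.
  by rewrite subr_eq0 eq_sym; apply: edwards_complete => //; rewrite expr1n.
rewrite addrC -[1]opprK subr_eq0.
by apply: edwards_complete => //; rewrite sqrrN expr1n.
Qed.

Lemma edwards_add_opp x y : edwards_curve d (x, y) ->
  edwards_add d (x, y) (- x, y) = (0, 1).
Proof.
move=> c; have cN : edwards_curve d (- x, y).
  by move: c; rewrite /edwards_curve /= sqrrN.
have [/= D1 D2] := edwards_add_denominators c cN.
rewrite /edwards_add /=; congr (_, _); first by rewrite mulNr subrr mul0r.
apply: (canLR (mulfK D2)); rewrite mul1r.
have -> : y * y - x * - x = x ^+ 2 + y ^+ 2 by ring.
by rewrite c /=; ring.
Qed.

Lemma edwards_addC P Q : edwards_add d P Q = edwards_add d Q P.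
Proof.
by rewrite /edwards_add; congr (_ / _, _ / _); ring.
Qed.

Lemma edwards_add0 P : edwards_add d (0, 1) P = P.
Proof.
case: P => x y; rewrite /edwards_add /=; congr (_, _).
  by rewrite mulr0 !mul0r addr0 divr1 mulr1 add0r.
by rewrite mulr0 !mul0r !subr0 divr1 mul1r.
Qed.

(** The usual map from a Montgomery curve, here [4 eta ^ 2 = xi ((xi + 1) ^ 2 - d (xi - 1) ^ 2)], to
    an Edwards curve. *)
Definition edwards_of_weierstrass (xi eta : K) := (xi / eta, (xi - 1) / (xi + 1)).
Local Notation F := edwards_of_weierstrass.

Lemma edwards_of_weierstrass_curve xi eta : eta != 0 -> xi + 1 != 0 ->
  4 * eta ^+ 2 = xi * ((xi + 1) ^+ 2 - d * (xi - 1) ^+ 2) ->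
  edwards_curve d (F xi eta).
Proof.
move=> eta0 xi0 c; rewrite /edwards_curve /=; apply/eqP; rewrite -subr_eq0.
have -> : (xi / eta) ^+ 2 + ((xi - 1) / (xi + 1)) ^+ 2 -
  (1 + d * (xi / eta) ^+ 2 * ((xi - 1) / (xi + 1)) ^+ 2) =
  (xi * (xi * ((xi + 1) ^+ 2 - d * (xi - 1) ^+ 2)) - xi * (4 * eta ^+ 2)) /
  (eta * (xi + 1)) ^+ 2 by field; rewrite eta0 xi0.
by rewrite c subrr mul0r.
Qed.

(* The three points lie on the line [eta = l xi + m], and the three equations
   on [l], [m] compare coefficients in
   [(1 - d) (xi - xi1) (xi - xi2) (xi - xi3) =
     xi ((xi + 1) ^+ 2 - d (xi - 1) ^+ 2) - 4 (l xi + m) ^+ 2]. *)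
Lemma edwards_of_weierstrass_add (l m x1 x2 x3 : K) :
  let y1 := l * x1 + m in let y2 := l * x2 + m in let y3 := - (l * x3 + m) in
  let e := 1 - d in
  e != 0 -> y1 != 0 -> y2 != 0 -> y3 != 0 ->
  x1 + 1 != 0 -> x2 + 1 != 0 -> x3 + 1 != 0 ->
  edwards_curve d (F x1 y1) -> edwards_curve d (F x2 y2) ->
  e * (x1 + x2 + x3) = 4 * l ^+ 2 - 4 + 2 * e ->
  e * (x1 * x2 + x1 * x3 + x2 * x3) = e - 8 * l * m ->
  e * (x1 * x2 * x3) = 4 * m ^+ 2 ->
  F x3 y3 = edwards_add d (F x1 y1) (F x2 y2).
Proof.
move=> y1 y2 y3 e e0 y10 y20 y30 x10 x20 x30 c1 c2 R1 R2 R3.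
have [/= D1 D2] := edwards_add_denominators c1 c2.
have dE : d = 1 - e by rewrite /e; ring.
pose s := x1 + x2; pose p := x1 * x2.
pose A := 1 - p - s * x3.
have L : 4 * l ^+ 2 = e * (s + x3 - 2) + 4.
  transitivity (4 * l ^+ 2 - 4 + 2 * e - 2 * e + 4); first by ring.
  by rewrite -R1 /s; ring.
have M : 8 * l * m = e * A.
  transitivity (e - (e - 8 * l * m)); first by ring.
  by rewrite -R2 /A /p /s; ring.
(* [R4] is [(8 l m) ^+ 2 = 4 (4 l ^+ 2) (4 m ^+ 2)]; with it, both coordinates
   follow from equations that are linear in [l ^+ 2], [l m] and [m ^+ 2]. *)
have R4 : 16 * p * x3 = e * (A ^+ 2 - 4 * p * x3 * (s + x3 - 2)).
  apply: (mulfI e0); apply/eqP; rewrite -subr_eq0; apply/eqP.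
  transitivity (4 * (e * (s + x3 - 2) + 4) * (e * (p * x3)) - (e * A) ^+ 2).
    by ring.
  by rewrite -L -M R3; ring.
have K8 : 8 != 0 :> K by rewrite (_ : 8 = 2 * 2 * 2) ?mulf_neq0//; ring.
have nE : y1 * y2 = l ^+ 2 * p + l * m * s + m ^+ 2.
  by rewrite /p /s /y1 /y2; ring.
have Fdef : d * (x1 / y1) * (x2 / y2) * ((x1 - 1) / (x1 + 1)) * ((x2 - 1) / (x2 + 1)) =
  d * p * (p - s + 1) / (y1 * y2 * (p + s + 1)).
  rewrite /p /s (_ : x1 * x2 + (x1 + x2) + 1 = (x1 + 1) * (x2 + 1)); last by ring.
  by field; rewrite y10 y20 x10 x20.
have ps0 : p + s + 1 != 0.
  by rewrite (_ : _ + _ = (x1 + 1) * (x2 + 1)) ?mulf_neq0// /p /s; ring.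
have y120 : y1 * y2 != 0 by rewrite mulf_neq0.
have Nx : x1 / y1 * ((x2 - 1) / (x2 + 1)) + x2 / y2 * ((x1 - 1) / (x1 + 1)) =
  (2 * l * p * (p - 1) + m * (s * (p - 1) - s ^+ 2 + 4 * p)) /
  (y1 * y2 * (p + s + 1)).
  rewrite /p /s (_ : x1 * x2 + (x1 + x2) + 1 = (x1 + 1) * (x2 + 1)); last by ring.
  transitivity ((x1 * y2 * (x1 + 1) * (x2 - 1) + x2 * y1 * (x2 + 1) * (x1 - 1)) /
     (y1 * y2 * ((x1 + 1) * (x2 + 1)))).
    by field; rewrite y10 y20 x10 x20.
  by congr (_ / _); rewrite /y1 /y2; ring.
have Ny : (x1 - 1) / (x1 + 1) * ((x2 - 1) / (x2 + 1)) - x1 / y1 * (x2 / y2) =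
  (y1 * y2 * (p - s + 1) - p * (p + s + 1)) / (y1 * y2 * (p + s + 1)).
  rewrite /p /s (_ : x1 * x2 + (x1 + x2) + 1 = (x1 + 1) * (x2 + 1)); last by ring.
  by field; rewrite y10 y20 x10 x20.
have Q0 : y1 * y2 * (p + s + 1) != 0 by rewrite mulf_neq0.
have cross (u w z N Q : K) : w != 0 -> Q != 0 ->
    u * (Q + z) = N * w -> u / w * (1 + z / Q) = N / Q.
  move=> w0 Q0' H; transitivity (u * (Q + z) / (w * Q)).
    by field; rewrite w0 Q0'.
  by rewrite H; field; rewrite w0 Q0'.
have R3' : 4 * m ^+ 2 = e * (p * x3) by rewrite -R3.
have R40 : 16 * p * x3 - e * (A ^+ 2 - 4 * p * x3 * (s + x3 - 2)) = 0.
  by rewrite R4 subrr.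
rewrite /edwards_add /=; congr (_, _).
  apply: (canRL (mulfK D1)); rewrite Fdef Nx; apply: cross => //.
  (* The factor 8 lets [l] and [m] occur only through [4 l ^ 2], [8 l m] and [4 m ^ 2], whose values
     are known. *)
  apply/eqP; rewrite -subr_eq0; apply/eqP; apply: (mulfI K8); rewrite mulr0 nE.
  transitivity (2 * (x3 * p * (p + s + 1) + 2 * p * x3 * (p - 1)) * (4 * l ^+ 2)
   + (x3 * s * (p + s + 1) + x3 * (s * (p - 1) - s ^+ 2 + 4 * p) + 2 * p * (p - 1))
       * (8 * l * m)
   + 2 * (x3 * (p + s + 1) + (s * (p - 1) - s ^+ 2 + 4 * p)) * (4 * m ^+ 2)
   + 8 * x3 * d * p * (p - s + 1)); first by rewrite /y3; ring.
  rewrite L M R3' dE.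
  transitivity (2 * p * (16 * p * x3 - e * (A ^+ 2 - 4 * p * x3 * (s + x3 - 2)))).
    by rewrite /A; ring.
  by rewrite R40 mulr0.
apply: (canRL (mulfK D2)); rewrite Fdef Ny -mulNr; apply: cross => //.
apply/eqP; rewrite eq_sym -subr_eq0; apply/eqP; apply: (mulfI K8); rewrite mulr0 nE.
pose B := (p - s + 1) * (x3 + 1) - (x3 - 1) * (p + s + 1).
transitivity (2 * p * B * (4 * l ^+ 2) + s * B * (8 * l * m) + 2 * B * (4 * m ^+ 2)
  - 8 * p * (p + s + 1) * (x3 + 1) + 8 * d * p * (x3 - 1) * (p - s + 1)).
  by rewrite /B; ring.
rewrite L M R3' dE.
transitivity (- 2 * s * (16 * p * x3 - e * (A ^+ 2 - 4 * p * x3 * (s + x3 - 2)))).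
  by rewrite /A /B; ring.
by rewrite R40 mulr0.
Qed.

End EdwardsComplete.

(** * The addition theorem for values *)

Section WeierstrassAddition.
Variables (K : dvalFieldType) (a b : K).
Hypothesis Kdef : wp_coef_defined K.
Local Notation g2 := (- 4 * a).
Local Notation g3 := (- 4 * b).
Local Notation P := (wp g2 g3).
Local Notation w := (wp_fps_at a b).
Local Notation h := (half_wp'_fps_at a b).
Definition half_wp' z := wp' g2 g3 z / 2.
Local Notation H := half_wp'.

Definition wp_converges z :=
  seq_cvg (wp_partial g2 g3 z) /\ seq_cvg (wp'_partial g2 g3 z).

Let natS_neq0 n : n.+1%:R != 0 :> K.
Proof. exact: wp_coef_defined_natr_neq0. Qed.

Lemma sums_half_wp' z : z != 0 -> wp_converges z -> sums (h z) (H z).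
Proof.
move=> z0 [_ cz]; rewrite /H mulrC; apply: sumsM (sumsC _) _; exact: sums_wp'.
Qed.

Lemma sums_wp_at z : z != 0 -> wp_converges z -> sums (w z) (P z).
Proof. by move=> z0 [cz _]; exact: sums_wp. Qed.

Ltac sums_tac := do ?[exact: sums_wp_at | exact: sums_half_wp'
  | exact: sumsC | exact: sumsX | exact: sums_nat
  | apply: sumsD | apply: sumsN | apply: sumsM | apply: sumsXn].

Lemma sumsCX c n : sums (fpsC c * fpsX K ^+ n) c.
Proof. by rewrite -[c in sums _ c]mulr1 -(expr1n K n); sums_tac. Qed.

Lemma wp_curve z : z != 0 -> wp_converges z ->
  H z ^+ 2 = P z ^+ 3 + a * P z + b.
Proof.
move=> z0 cz; apply: (@sums_unique _ (h z ^+ 2)); first by sums_tac.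
rewrite half_wp'_fps_at_curve//.
apply: sumsD (sumsCX _ _); apply: sumsD; first by sums_tac.
by apply: sumsM (sumsCX _ _) _; sums_tac.
Qed.

Lemma wp_opp z : z != 0 -> wp_converges z -> wp_converges (- z) ->
  P (- z) = P z /\ H (- z) = - H z.
Proof.
move=> z0 cz cNz; have Nz0 : - z != 0 by rewrite oppr_eq0.
split.
  apply: (@sums_unique _ (w z)); last by sums_tac.
  have -> : w z = w (- z) by rewrite /w sqrrN.
  by sums_tac.
apply: (@sums_unique _ (- h z)); last by sums_tac.
have -> : - h z = h (- z).
  rewrite /half_wp'_fps_at -mulrN; congr (_ * _); apply: fpsP => n.
  rewrite fps_coefN !wp'_fps_atE sqrrN.
  by rewrite exprNn -signr_odd /= expr1 mulN1r invrN !mulNr.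
by sums_tac.
Qed.

Lemma wp_chord u v : u != 0 -> v != 0 -> u + v != 0 -> u - v != 0 ->
  wp_converges u -> wp_converges v -> wp_converges (u + v) ->
  (P u - P v) ^+ 2 * (P (u + v) + P u + P v) = (H u - H v) ^+ 2 /\
  (P u - P v) * (H (u + v) + H u) + (H u - H v) * (P (u + v) - P u) = 0.
Proof.
move=> u0 v0 uv0 uv0' cu cv cuv.
have [e1 e2] := wp_fps_chord a b Kdef u0 v0 uv0 uv0'; split.
  by apply: (@sums_unique _ ((h u - h v) ^+ 2)); [rewrite -e1|]; sums_tac.
by apply: (@sums_unique _ 0); [rewrite -e2; sums_tac|exact: (sums_nat _ 0)].
Qed.

Lemma wp_tangent u : u != 0 -> wp_converges u -> wp_converges (2 * u) ->
  4 * H u ^+ 2 * (P (2 * u) + 2 * P u) = (3 * P u ^+ 2 + a) ^+ 2 /\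
  2 * H u * (H (2 * u) + H u) + (3 * P u ^+ 2 + a) * (P (2 * u) - P u) = 0.
Proof.
move=> u0 cu c2u; have u20 : 2 * u != 0 by rewrite mulf_neq0.
have [e1 e2] := wp_fps_tangent a b Kdef u0.
split.
  apply: (@sums_unique _ ((3 * w u ^+ 2 + fpsC a * fpsX K ^+ 2) ^+ 2)).
    by rewrite -e1; sums_tac.
  by apply: sumsXn; apply: sumsD (sumsCX _ _); sums_tac.
apply: (@sums_unique _ 0); last exact: (sums_nat _ 0).
rewrite -e2; apply: sumsD; first by sums_tac.
by apply: sumsM; [apply: sumsD (sumsCX _ _)|]; sums_tac.
Qed.

Hypothesis nonsingular : forall x, x ^+ 3 + a * x + b = 0 -> 3 * x ^+ 2 + a != 0.

(* Were [H u = 0], the duplication formula would make [u] a singular point,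
   since [wp] has no pole at [2 * u]. *)
Lemma half_wp'_neq0 u : u != 0 -> wp_converges u -> wp_converges (2 * u) ->
  H u != 0.
Proof.
move=> u0 cu c2u; apply/eqP => Hu0; have [e _] := wp_tangent u0 cu c2u.
have := wp_curve u0 cu; rewrite Hu0 expr0n => /esym /nonsingular/negP; apply.
by rewrite -sqrf_eq0 -e Hu0 expr0n mulr0 mul0r.
Qed.

(** The last three equations are Vieta's formulas for [x ^ 3 + a x + b - (L x + M) ^ 2], whose roots
    are the abscissas of the three collinear points. In this form the chord and the tangent need no
    separate treatment later. *)
Lemma wp_line u v : u != 0 -> v != 0 -> u + v != 0 ->
  wp_converges u -> wp_converges v -> wp_converges (- v) ->
  wp_converges (u + v) -> wp_converges (u - v) -> wp_converges (2 * u) ->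
  exists L M, [/\ H u = L * P u + M, H v = L * P v + M
    & H (u + v) = - (L * P (u + v) + M)] /\
   [/\ P u + P v + P (u + v) = L ^+ 2,
    P u * P v + P u * P (u + v) + P v * P (u + v) = a - 2 * L * M
    & P u * P v * P (u + v) = M ^+ 2 - b].
Proof.
move=> u0 v0 uv0 cu cv cNv cuv cuv' c2u.
have Hu := wp_curve u0 cu; have Hv := wp_curve v0 cv.
have Hu0 := half_wp'_neq0 u0 cu c2u.
have [uv|uv] := eqVneq u v.
  subst v; have [] := wp_tangent u0 cu c2u.
  rewrite (_ : 2 * u = u + u); last by ring.
  move: (P u) (H u) (P (u + u)) (H (u + u)) Hu Hu0 => x k x3 k3 Hk k0 e1 e2.
  have Di : 2 * k * (2 * k)^-1 = 1 by rewrite divff ?mulf_neq0.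
  have k20 : 2 * k != 0 by rewrite mulf_neq0.
  pose L := (3 * x ^+ 2 + a) / (2 * k).
  have aE : a = 2 * L * k - 3 * x ^+ 2 := @tangent_param _ x k _ a Di.
  have x3E : x3 = L ^+ 2 - 2 * x.
    apply: (mulfI (expf_neq0 2 k20)); rewrite /L.
    apply/eqP; rewrite -subr_eq0; apply/eqP.
    transitivity (4 * k ^+ 2 * (x3 + 2 * x) - (3 * x ^+ 2 + a) ^+ 2).
      by field; rewrite k0 natS_neq0.
    by rewrite e1 subrr.
  have k3E : k3 = - (k + L * (x3 - x)).
    apply: (mulfI k20); apply/eqP; rewrite -subr_eq0; apply/eqP; rewrite -e2 /L.
    by field; rewrite k0 natS_neq0.
  have bE : b = k ^+ 2 - x ^+ 3 - a * x by rewrite Hk; ring.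
  (* With [L] made a free variable, the claims are polynomial identities in [x], [k] and [L]. *)
  move: {e1 e2} L aE x3E k3E => L aE x3E k3E.
  exists L, (k - L * x); split; split; rewrite ?bE ?aE ?k3E ?x3E //; clear; ring.
have uv0' : u - v != 0 by rewrite subr_eq0.
(* If [P u = P v], the chord formulas for [v] and for [- v] give [H u = H v] and
   [H u = - H v]. *)
have xy0 : P u - P v != 0.
  apply/eqP => xy; have [e _] := wp_chord u0 v0 uv0 uv0' cu cv cuv.
  have Nv0 : - v != 0 by rewrite oppr_eq0.
  have [] := @wp_chord u (- v); rewrite ?opprK//.
  have [-> ->] := wp_opp v0 cv cNv; rewrite opprK xy => e' _.
  move: e e'; rewrite xy expr0n !mul0r => /esym/eqP; rewrite sqrf_eq0 => /eqP e.
  move/esym/eqP; rewrite sqrf_eq0 => /eqP e'.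
  move/eqP: e; rewrite subr_eq0 => /eqP e.
  move/eqP: e'; rewrite -e -mulr2n -mulr_natl mulf_eq0 (negPf Hu0) orbF.
  by rewrite (negPf (natS_neq0 1)).
have [] := wp_chord u0 v0 uv0 uv0' cu cv cuv.
move: (P u) (H u) (P v) (H v) (P (u + v)) (H (u + v)) Hu Hv Hu0 xy0.
move=> x h1 y h2 x3 h3 c1 c2 h10 D0 e1 e2.
have Di := divff D0.
have [h1E aE bE] := chord_param Di c1 c2.
pose L := (h1 - h2) / (x - y); rewrite -/L in h1E aE.
have x3E : x3 = L ^+ 2 - x - y.
  apply: (mulfI (expf_neq0 2 D0)).
  apply/eqP; rewrite -subr_eq0; apply/eqP.
  transitivity ((x - y) ^+ 2 * (x3 + x + y) - (h1 - h2) ^+ 2).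
    by rewrite /L; field.
  by rewrite e1 subrr.
have h3E : h3 = - (h1 + L * (x3 - x)).
  apply: (mulfI D0); apply/eqP; rewrite -subr_eq0; apply/eqP; rewrite -e2 /L.
  by field.
move: {e1 e2} L h1E aE x3E h3E => L h1E aE x3E h3E.
exists L, (h2 - L * y); split; split; rewrite ?bE ?aE ?h3E ?x3E ?h1E //; clear; ring.
Qed.

End WeierstrassAddition.

(** * From Weierstrass to Edwards coordinates *)

Section EdwardsCoordinates.
Variables (K : fieldType) (d x1 y1 : K).
Hypotheses (K2 : 2 != 0 :> K) (K3 : 3 != 0 :> K) (dns : ~ is_square d)
  (d1 : 1 - d != 0) (x10 : x1 != 0) (y1E : y1 ^+ 2 = 4 * x1 ^+ 3 / (1 - d)).
Local Notation a' := (2 * x1 * ((1 + d) / (1 - d))).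
Local Notation a := (short_a a' (x1 ^+ 2)).
Local Notation b := (short_b a' (x1 ^+ 2)).

(** Subtracting [a' / 3] returns to the abscissa on [y ^ 2 = x ^ 3 + a' x ^ 2 + b' x]; scaling by
    [x1] and [y1] leaves a cubic that depends on [d] alone. *)
Definition edwards_xi x := (x - a' / 3) / x1.
Definition edwards_eta y := y / y1.
Local Notation xi := edwards_xi.
Local Notation eta := edwards_eta.

Let K4 : 4 != 0 :> K.
Proof. by rewrite (_ : 4 = 2 * 2) ?mulf_neq0//; ring. Qed.

Let K27 : 27 != 0 :> K.
Proof. by rewrite (_ : 27 = 3 * 3 * 3) ?mulf_neq0//; ring. Qed.

Let d0 : d != 0.
Proof. by apply/eqP => d0; apply: dns; exists 0; rewrite d0 expr0n. Qed.

Lemma y1_neq0 : y1 != 0.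
Proof.
by rewrite -sqrf_eq0 y1E mulf_neq0 ?invr_eq0// mulf_neq0 ?expf_neq0.
Qed.

Lemma xi_inv x : x = x1 * xi x + a' / 3.
Proof. by rewrite /edwards_xi mulrC divfK// subrK. Qed.

Lemma short_weierstrass_xi x : x ^+ 3 + a * x + b =
  x1 ^+ 3 / (1 - d) * (xi x * ((xi x + 1) ^+ 2 - d * (xi x - 1) ^+ 2)).
Proof.
by rewrite {1 2}(xi_inv x) /short_a /short_b; field; rewrite K3 K27 d1.
Qed.

Lemma edwards_xi_eta x y : y ^+ 2 = x ^+ 3 + a * x + b ->
  4 * eta y ^+ 2 = xi x * ((xi x + 1) ^+ 2 - d * (xi x - 1) ^+ 2).
Proof.
move=> c; rewrite expr_div_n y1E c short_weierstrass_xi.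
by field; rewrite d1 x10 K4.
Qed.

(** In the coordinate [xi] the cubic is, up to a nonzero factor, [xi] times a quadratic with
    constant term [1 - d] and discriminant [16 d]. Both are nonzero, so there is no double root. *)
Lemma short_weierstrass_nonsingular x :
  x ^+ 3 + a * x + b = 0 -> 3 * x ^+ 2 + a != 0.
Proof.
have aE : 3 * x ^+ 2 + a = x1 ^+ 2 / (1 - d) *
    ((1 - d) * (3 * xi x ^+ 2 + 1) + 4 * (1 + d) * xi x).
  by rewrite {1}(xi_inv x) /short_a; field; rewrite K3 d1.
have k0 n : x1 ^+ n / (1 - d) != 0 by rewrite mulf_neq0 ?invr_eq0 ?expf_neq0.
rewrite short_weierstrass_xi aE mulf_eq0 (negPf (k0 _)) /=.
move: (xi x) => u /eqP; rewrite mulf_eq0 (negPf (k0 _)) /= mulf_eq0 => c.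
apply/eqP => s; case/orP: c => [/eqP u0|/eqP c].
  by move: s; rewrite u0 expr0n !mulr0 addr0 add0r mulr1; apply/eqP.
(* Half the derivative of the quadratic factor vanishes at its root [u]. *)
have c' : (1 - d) * u + (1 + d) = 0.
  have u0 : u != 0.
    by apply/eqP => u0; move: c; rewrite u0 add0r sub0r sqrrN expr1n mulr1; apply/eqP.
  apply: (mulfI (mulf_neq0 K2 u0)); rewrite mulr0.
  transitivity ((1 - d) * (3 * u ^+ 2 + 1) + 4 * (1 + d) * u -
     ((u + 1) ^+ 2 - d * (u - 1) ^+ 2)); first by ring.
  by rewrite s c subrr.
have : 4 * d == 0.
  apply/eqP; transitivity (((1 - d) * u + (1 + d)) ^+ 2 -
     (1 - d) * ((u + 1) ^+ 2 - d * (u - 1) ^+ 2)); first by ring.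
  by rewrite c c' expr0n mulr0 subrr.
by rewrite mulf_eq0 (negPf K4) (negPf d0).
Qed.

(** At [xi = -1] the cubic equation reads [eta ^ 2 = d]. *)
Lemma edwards_xi_neqN1 x y : y ^+ 2 = x ^+ 3 + a * x + b -> xi x + 1 != 0.
Proof.
move=> /edwards_xi_eta c; apply/eqP => u0; apply: dns; exists (eta y).
apply: (mulfI K4); rewrite c u0 (_ : xi x = - 1); first by ring.
by apply/eqP; rewrite -addr_eq0 u0.
Qed.

(** The change of coordinates is affine in each variable, so lines and Vieta's formulas carry over;
    the relations depend on [y1] only through [4 / y1 ^ 2 = (1 - d) / x1 ^ 3]. *)
Lemma edwards_of_weierstrass_line L M u v w :
  u + v + w = L ^+ 2 -> u * v + u * w + v * w = a - 2 * L * M ->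
  u * v * w = M ^+ 2 - b ->
  let l := L * x1 / y1 in let m := (M + L * (a' / 3)) / y1 in let e := 1 - d in
  [/\ forall x, eta (L * x + M) = l * xi x + m,
    e * (xi u + xi v + xi w) = 4 * l ^+ 2 - 4 + 2 * e,
    e * (xi u * xi v + xi u * xi w + xi v * xi w) = e - 8 * l * m
  & e * (xi u * xi v * xi w) = 4 * m ^+ 2].
Proof.
move=> s1 s2 s3 l m e; have y10 := y1_neq0.
have eE : 4 / y1 ^+ 2 = e / x1 ^+ 3.
  by rewrite y1E /e; field; rewrite d1 x10 K4.
have l2 : 4 * l ^+ 2 = e * L ^+ 2 / x1.
  transitivity (4 / y1 ^+ 2 * (L * x1) ^+ 2); first by rewrite /l; field.
  by rewrite eE; field.
have lm : 8 * l * m = 2 * e * L * (M + L * (a' / 3)) / x1 ^+ 2.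
  transitivity (4 / y1 ^+ 2 * (2 * L * x1 * (M + L * (a' / 3)))).
    by rewrite /l /m; move: (a' / 3) => A; field.
  by rewrite eE; move: (a' / 3) => A; field.
have m2 : 4 * m ^+ 2 = e * (M + L * (a' / 3)) ^+ 2 / x1 ^+ 3.
  transitivity (4 / y1 ^+ 2 * (M + L * (a' / 3)) ^+ 2).
    by rewrite /m; move: (a' / 3) => A; field.
  by rewrite eE; move: (a' / 3) => A; field.
split.
- move=> x; rewrite /edwards_eta /edwards_xi /l /m; move: (a' / 3) => A.
  by field; rewrite y10 x10.
- by rewrite l2 -s1 /edwards_xi /e; field; rewrite d1 x10 K3.
- rewrite lm.
  transitivity (e * ((u * v + u * w + v * w) - 2 * (a' / 3) * (u + v + w)
      + 3 * (a' / 3) ^+ 2) / x1 ^+ 2).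
    by rewrite /edwards_xi; move: (a' / 3) => A; field.
  by rewrite s1 s2 /short_a /e; field; rewrite d1 x10 K3.
- rewrite m2.
  transitivity (e * (u * v * w - (a' / 3) * (u * v + u * w + v * w)
      + (a' / 3) ^+ 2 * (u + v + w) - (a' / 3) ^+ 3) / x1 ^+ 3).
    by rewrite /edwards_xi; move: (a' / 3) => A; field.
  by rewrite s1 s2 s3 /short_a /short_b /e; field; rewrite d1 x10 K3 K27.
Qed.

End EdwardsCoordinates.

(** * The exponential map of the Edwards curve *)

Theorem theorem3p1 (K : localFieldType) (d x1 y1 : K) :
  2%N \notin [pchar K] ->
  ~ is_square d ->
  d * (d - 1) != 0 ->
  x1 != 0 ->
  (is_square x1 /\ is_square (1 - d)) \/
    (~ is_square x1 /\ ~ is_square (1 - d)) ->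
  y1 ^+ 2 = 4 * x1 ^+ 3 / (1 - d) ->
  let a' : K := 2 * x1 * ((1 + d) / (1 - d)) in
  let b' : K := x1 ^+ 2 in
  let a := short_a a' b' in
  let b := short_b a' b' in
  let g2 := - 4 * a in
  let g3 := - 4 * b in
  let Exp (z : integer_ring K) := edwards_exp g2 g3 a' x1 y1 (int_val z) in
  3 != 0 :> K ->
  edwards_good_reduction d ->
  weierstrass_good_reduction a' b' 0 ->
  weierstrass_good_reduction 0 a b ->
  wp_coef_defined K ->
  (forall z : integer_ring K, z \in @max_ideal K ->
     seq_cvg (wp_partial g2 g3 (int_val z)) /\
     seq_cvg (wp'_partial g2 g3 (int_val z))) ->
  [/\ forall z : integer_ring K, z \in @max_ideal K -> z != 0 ->
        wp' g2 g3 (int_val z) != 0 /\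
        3 * wp g2 g3 (int_val z) - a' + 3 * x1 != 0,
      forall z : integer_ring K, z \in @max_ideal K -> edwards_curve d (Exp z)
    & forall z1 z2 : integer_ring K,
        z1 \in @max_ideal K -> z2 \in @max_ideal K ->
        Exp (z1 + z2) = edwards_add d (Exp z1) (Exp z2)].
Proof.
move=> _ dns dd1 x10 _ y1E a' b' a b g2 g3 Exp K3 _ _ _ Kdef conv.
have K2 : 2 != 0 :> K := wp_coef_defined_natr_neq0 1 Kdef.
have d1 : 1 - d != 0.
  by move: dd1; rewrite mulf_eq0 negb_or => /andP[_]; rewrite -opprB oppr_eq0.
have y10 : y1 != 0 := y1_neq0 K2 d1 x10 y1E.
(* The maximal ideal as a subset of [K], which avoids the coercion from the ring of integers. *)
pose m (z : K) := (0 < valuation z)%E.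
have mD u v : m u -> m v -> m (u + v).
  by move=> mu mv; apply: lt_le_trans (valuationD u v); rewrite lt_min; apply/andP.
have mN u : m u -> m (- u) by rewrite /m valuationN.
have cvm u : m u -> wp_converges a b u.
  move=> mu; have iu : u \in @is_integer K by rewrite unfold_in; exact: ltW.
  by have := conv (Integer iu); apply; rewrite unfold_in.
have ns := short_weierstrass_nonsingular K2 K3 dns d1 x10.
pose P z := wp g2 g3 z; pose H z := half_wp' a b z.
pose xi z := edwards_xi d x1 (P z); pose eta z := edwards_eta y1 (H z).
have curve z : m z -> z != 0 -> H z ^+ 2 = P z ^+ 3 + a * P z + b.
  by move=> mz z0; apply: wp_curve => //; exact: cvm.
have m2 z : m z -> m (2 * z).
  by move=> mz; rewrite mulr_natl mulr2n; exact: mD.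
have H0 z : m z -> z != 0 -> H z != 0.
  by move=> mz z0; apply: half_wp'_neq0 => //; apply: cvm => //; exact: m2.
have eta0 z : m z -> z != 0 -> eta z != 0.
  by move=> mz z0; rewrite mulf_neq0 ?invr_eq0// H0.
have xi0 z : m z -> z != 0 -> xi z + 1 != 0.
  by move=> mz z0; exact: (edwards_xi_neqN1 K2 K3 dns d1 x10 y1E (curve z mz z0)).
have xiE z : 3 * P z - a' = 3 * x1 * xi z.
  by rewrite /xi /edwards_xi -/a'; field; rewrite K3 x10.
have H2 z : wp' g2 g3 z = 2 * y1 * eta z.
  by rewrite /eta /edwards_eta /H /half_wp' -/g2 -/g3; field; rewrite K2 y10.
pose E z := edwards_exp g2 g3 a' x1 y1 z.
have E0 : E 0 = (0, 1) by rewrite /E /edwards_exp eqxx.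
have EF z : m z -> z != 0 -> E z = edwards_of_weierstrass (xi z) (eta z).
  move=> mz z0; rewrite /E /edwards_exp (negPf z0) -/(P z) xiE H2.
  have := eta0 z mz z0; have := xi0 z mz z0.
  move: (xi z) (eta z) => u w u0 w0; rewrite /edwards_of_weierstrass.
  congr (_, _); first by field; rewrite K2 K3 x10 y10 w0.
  rewrite (_ : 3 * x1 * u + 3 * x1 = 3 * x1 * (u + 1)); last by ring.
  by field; rewrite K3 x10 u0.
have Ecurve z : m z -> edwards_curve d (E z).
  move=> mz; have [->|z0] := eqVneq z 0.
    by rewrite E0 /edwards_curve /=; ring.
  rewrite EF//; apply: edwards_of_weierstrass_curve; rewrite ?eta0 ?xi0//.
  exact: (edwards_xi_eta K2 K3 d1 x10 y1E (curve z mz z0)).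
have Eadd u v : m u -> m v -> E (u + v) = edwards_add d (E u) (E v).
  move=> mu mv.
  have [->|u0] := eqVneq u 0; first by rewrite add0r E0 edwards_add0.
  have [->|v0] := eqVneq v 0.
    by rewrite addr0 E0 edwards_addC edwards_add0.
  (* When [v = - u] the line is vertical. Since [wp] is even and [wp'] odd, the first Edwards
     coordinate changes sign, which gives the opposite point. *)
  have [uv0|uv0] := eqVneq (u + v) 0.
    have -> : v = - u by apply/eqP; rewrite -addr_eq0 addrC uv0.
    have Nu0 : - u != 0 by rewrite oppr_eq0.
    have [PN HN] := wp_opp u0 (cvm u mu) (cvm _ (mN u mu)).
    have xiN : xi (- u) = xi u by rewrite /xi /P PN.
    have etaN : eta (- u) = - eta u by rewrite /eta /H HN [LHS]mulNr.
    have := Ecurve u mu; rewrite subrr E0 !EF ?mN// xiN etaN.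
    rewrite /edwards_of_weierstrass invrN mulrN => c.
    by rewrite edwards_add_opp.
  (* In the remaining case all three arguments are nonzero, and the line of [wp_line], rewritten in
     [xi] and [eta], feeds [edwards_of_weierstrass_add]. *)
  have muv := mD u v mu mv.
  have [L [M [[e1 e2 e3] [s1 s2 s3]]]] := wp_line Kdef ns u0 v0 uv0 (cvm u mu)
    (cvm v mv) (cvm _ (mN v mv)) (cvm _ muv) (cvm _ (mD _ _ mu (mN v mv)))
    (cvm _ (m2 u mu)).
  have [lin R1 R2 R3] := edwards_of_weierstrass_line K2 K3 d1 x10 y1E s1 s2 s3.
  have cu := Ecurve u mu; have cv := Ecurve v mv.
  have nu := eta0 u mu u0; have nv := eta0 v mv v0; have nuv := eta0 _ muv uv0.
  have eu : eta u = L * x1 / y1 * xi u + (M + L * (a' / 3)) / y1.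
    by rewrite /eta /H e1; exact: lin.
  have ev : eta v = L * x1 / y1 * xi v + (M + L * (a' / 3)) / y1.
    by rewrite /eta /H e2; exact: lin.
  have euv : eta (u + v) = - (L * x1 / y1 * xi (u + v) + (M + L * (a' / 3)) / y1).
    by rewrite /eta /H e3 -lin; exact: mulNr.
  move: cu cv; rewrite !EF//; rewrite eu in nu *; rewrite ev in nv *.
  rewrite euv in nuv *; move=> cu cv.
  by apply: edwards_of_weierstrass_add; rewrite ?xi0.
have mE (z : integer_ring K) : z \in @max_ideal K -> m (int_val z) by [].
split.
- move=> z /mE mz z0; have z0' : int_val z != 0 by [].
  rewrite H2 -/(P _) xiE; split; first by rewrite mulf_neq0 ?eta0 ?mulf_neq0.
  rewrite (_ : _ + _ = 3 * x1 * (xi (int_val z) + 1)); last by ring.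
  by rewrite mulf_neq0 ?xi0 ?mulf_neq0.
- by move=> z /mE; exact: Ecurve.
by move=> z1 z2 /mE mz1 /mE mz2; rewrite /Exp -/(E _) Eadd.
Qed.
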